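(* For any $g\in\mathrm{G}$, regarding the initial value problem (IVP) $x'=g(t,x)$, $x(0)=0$, the following hold. 1 (Global existence and uniqueness). This IVP has a unique maximal solution $\varphi$, which is a strictly increasing and unbounded path in $C^1_0$, so is always the unique global solution. 2 (Upper bound). This unique global solution $\varphi$ is bounded above by the strictly increasing and unbounded càdlàg path $\overline{\varphi}\in D(\mathbb{R}_+,\mathbb{R}_+)$ which is well-defined over $\mathbb{R}_+$ by $\overline{\varphi}(t):=\inf\{x>0:g(t,x)<0\}$. 3 (Continuous dependence). The solution map, from $\mathrm{G}$ to $C^1_0$, taking $g$ to the global solution of $x'=g(t,x)$, $x(0)=0$, is continuous with respect to uniform convergence over compacts. That is, for $\{g_n\}_{n\in\mathbb{N}_0}\subset\mathrm{G}$ with respective global solutions $\{\varphi_n\}_{n\in\mathbb{N}_0}$, $$\Vert g_0-g_n\Vert_{\mathbb{R}_+^2}\xrightarrow{n\to\infty}0\ \implies\ \Vert\varphi_0-\varphi_n\Vert_{\mathbb{R}_+}\xrightarrow{n\to\infty}0.$$ 4 (Simulation convergence). For any sequence of partitions $\{\pi_n\}_{n\in\mathbb{N}}\subset\Pi(\mathbb{R}_+)$ with $\Vert\pi_n\Vert_{\mathbb{R}_+}\xrightarrow{n\to\infty}0$, the sequence of (positive-part) forward Euler $\pi_n$-polygons $\varphi_{\pi_n}$ for this IVP converges to $\varphi$ uniformly over compacts as $n\to\infty$.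
   Context: $\mathbb{R}_+=[0,\infty)$, $\mathbb{N}_0=\{0,1,2,\dots\}$, $C^1_0:=C^1_0(\mathbb{R}_+,\mathbb{R}_+)$ is the set of continuously differentiable paths from $\mathbb{R}_+$ to $\mathbb{R}_+$ starting from $0$ at time $0$, and $D(\mathbb{R}_+,\mathbb{R}_+)$ is the set of càdlàg paths. $\mathrm{G}\subset C(\mathbb{R}_+^2,\mathbb{R})$ is the set of continuous $g:\mathbb{R}_+^2\to\mathbb{R}$, $(t,x)\mapsto g(t,x)$, such that: (i) $g(0,0)\ge0$; (ii) $g(\cdot,x)$ is strictly increasing for each $x\in\mathbb{R}_+$; (iii) $\inf_{x\in\mathbb{R}_+}g(t,x)<0$ for all $t\in\mathbb{R}_+$; (iv) $\sup_{t\in\mathbb{R}_+}g(t,x)>0$ for all $x\in\mathbb{R}_+$. A maximal solution of $x'=g(t,x)$, $x(0)=0$ is $\varphi\in C^1([0,T_* ),\mathbb{R}_+)$ for some $T_*\in(0,\infty]$ with $\varphi(0)=0$, $\varphi'(t)=g(t,\varphi(t))$ on $[0,T_* )$ and $T_*\vee\sup_{t\in[0,T_* )}|\varphi(t)|=\infty$; it is global if $T_*=\infty$. Norms characterising uniform convergence over compacts: $\Vert w\Vert_{\mathbb{R}_+}:=\sum_{n\in\mathbb{N}}2^{-n}(1\wedge\sup_{t\in[0,n]}|w(t)|)$ for paths, and $\Vert g\Vert_{\mathbb{R}_+^2}:=\sum_{n\in\mathbb{N}}2^{-n}(1\wedge\sup_{[0,n]^2}|g|)$ for functions on $\mathbb{R}_+^2$.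 A partition $\pi\in\Pi(\mathbb{R}_+)$ is an unbounded set $\{t_k\}_{k\in\mathbb{N}_0}$ with $0=t_0<t_1<\cdots$; $\Vert\pi\Vert_{[0,T]}:=\max_k\{t_{k+1}\wedge T-t_k\wedge T\}$ and $\Vert\pi\Vert_{\mathbb{R}_+}:=\sum_{n\in\mathbb{N}}2^{-n}(1\wedge\Vert\pi\Vert_{[0,n]})$. The (positive-part) forward Euler $\pi$-polygon is given by $\varphi_\pi(0):=0$ and recursively, for $t\in(t_k,t_{k+1}]$, $\varphi_\pi(t):=\max\{0,\varphi_\pi(t_k)+(t-t_k)g(t_k,\varphi_\pi(t_k))\}$. *)

(* Defs.v *)
From mathcomp Require Import all_boot all_order all_algebra.
From mathcomp Require Import all_classical all_reals all_analysis.

Set Implicit Arguments.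
Unset Strict Implicit.
Unset Printing Implicit Defensive.

Import Order.TTheory GRing.Theory Num.Theory.
Import numFieldNormedType.Exports.

Local Open Scope classical_set_scope.
Local Open Scope ring_scope.

(* Paths on R_+ (resp. functions on R_+^2) are total functions R -> R (resp.
   R * R -> R) of which only the values on R_+ (resp. R_+^2) are constrained;
   continuity, differentiability and equality are always relative to that
   domain. *)

Definition Rplus (R : realType) : set R := [set t | 0 <= t].
Arguments Rplus : clear implicits.

Definition Rplus2 (R : realType) : set (R * R) :=
  [set p | 0 <= p.1 /\ 0 <= p.2].
Arguments Rplus2 : clear implicits.

(* The interval [0, T), for T in (0, +oo]. *)
Definition before (R : realType) (T : \bar R) : set R :=
  [set t | 0 <= t /\ (t%:E < T)%E].

(* The derivative of f at t relative to D is l. For D = [0, T) or R_+ this is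
   the right derivative at t = 0 and the usual derivative at interior points. *)
Definition has_derivative_within (R : realType) (D : set R) (f : R -> R)
    (t l : R) : Prop :=
  (s - t)^-1 * (f s - f t) @[s --> within D t^'] --> l.

Definition C1_on (R : realType) (D : set R) (f : R -> R) : Prop :=
  exists f' : R -> R,
    (forall t, D t -> has_derivative_within D f t (f' t)) /\
    {within D, continuous f'}.

Definition nonneg_on (R : realType) (D : set R) (f : R -> R) : Prop :=
  forall t, D t -> 0 <= f t.

Definition C1_0 (R : realType) (f : R -> R) : Prop :=
  [/\ C1_on (Rplus R) f, nonneg_on (Rplus R) f & f 0 = 0].

Definition cadlag (R : realType) (f : R -> R) : Prop :=
  [/\ nonneg_on (Rplus R) f,
      forall t : R, 0 <= t -> f s @[s --> t^'+] --> f t &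
      forall t : R, 0 < t -> exists l : R, f s @[s --> t^'-] --> l].

Definition strictly_increasing (R : realType) (f : R -> R) : Prop :=
  forall s t : R, 0 <= s -> s < t -> f s < f t.

Definition unbounded (R : realType) (f : R -> R) : Prop :=
  ~ [bounded f t | t in Rplus R].

(* The infima and suprema are taken in the extended reals, since they need not
   be finite. *)
Definition classG (R : realType) (g : R * R -> R) : Prop :=
  {within Rplus2 R, continuous g} /\
  [/\ 0 <= g (0, 0),
      forall x : R, 0 <= x -> strictly_increasing (fun t => g (t, x)),
      forall t : R, 0 <= t ->
        (ereal_inf [set (g (t, x))%:E | x in Rplus R] < 0)%E &
      forall x : R, 0 <= x ->
        (0 < ereal_sup [set (g (t, x))%:E | t in Rplus R])%E].

Definition maximal_solution (R : realType) (g : R * R -> R) (T : \bar R)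
    (phi : R -> R) : Prop :=
  [/\ (0 < T)%E,
      C1_on (before T) phi /\ nonneg_on (before T) phi,
      phi 0 = 0,
      forall t, before T t ->
        has_derivative_within (before T) phi t (g (t, phi t)) &
      maxe T (ereal_sup [set `|phi t|%:E | t in before T]) = +oo%E].

Definition global_solution (R : realType) (g : R * R -> R) (phi : R -> R) :
  Prop := maximal_solution g +oo%E phi.

Definition unique_maximal_solution (R : realType) (g : R * R -> R)
    (T : \bar R) (phi : R -> R) : Prop :=
  maximal_solution g T phi /\
  forall T' psi, maximal_solution g T' psi ->
    T' = T /\ {in before T, psi =1 phi}.

Definition unique_global_solution (R : realType) (g : R * R -> R)
    (phi : R -> R) : Prop :=
  global_solution g phi /\
  forall psi, global_solution g psi -> {in Rplus R, psi =1 phi}.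

Definition upper_set (R : realType) (g : R * R -> R) (t : R) : set R :=
  [set x | 0 < x /\ g (t, x) < 0].

Definition phibar (R : realType) (g : R * R -> R) (t : R) : R :=
  inf (upper_set g t).

(* The sum over n >= 1 of 2^-n (1 /\ a n). *)
Definition weighted_sum (R : realType) (a : nat -> \bar R) : \bar R :=
  (\sum_(1 <= n <oo) ((2^-1 ^+ n)%:E * mine 1 (a n)))%E.

Definition path_norm (R : realType) (w : R -> R) : \bar R :=
  weighted_sum (fun n => ereal_sup [set `|w t|%:E | t in `[0, n%:R]]).

Definition field_norm (R : realType) (g : R * R -> R) : \bar R :=
  weighted_sum (fun n =>
    ereal_sup [set `|g p|%:E | p in `[0, n%:R] `*` `[0, n%:R]]).

(* A partition is given by its increasing enumeration. *)
Definition is_partition (R : realType) (pi : nat -> R) : Prop :=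
  [/\ pi 0%N = 0, forall k, pi k < pi k.+1 & ~ has_ubound (range pi)].

(* For a partition, only finitely many terms are nonzero, so that the supremum
   is a maximum. *)
Definition mesh (R : realType) (pi : nat -> R) (T : R) : \bar R :=
  ereal_sup (range (fun k => (Num.min (pi k.+1) T - Num.min (pi k) T)%:E)).

Definition partition_norm (R : realType) (pi : nat -> R) : \bar R :=
  weighted_sum (fun n => mesh pi n%:R).

Fixpoint euler_node (R : realType) (g : R * R -> R) (pi : nat -> R) (k : nat) :
    R :=
  if k is j.+1 then
    Num.max 0 (euler_node g pi j +
               (pi j.+1 - pi j) * g (pi j, euler_node g pi j))
  else 0.

(* For t > 0, the index k below is the one with t in (pi k, pi k.+1]; the
   recursion usually taken as the definition is euler_polygonS. *)
Definition euler_polygon (R : realType) (g : R * R -> R) (pi : nat -> R)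
    (t : R) : R :=
  if t <= 0 then 0 else
    let k := xget 0%N [set k | pi k < t <= pi k.+1] in
    Num.max 0 (euler_node g pi k + (t - pi k) * g (pi k, euler_node g pi k)).

Section EulerPolygon.
Context (R : realType) (g : R * R -> R) (pi : nat -> R)
  (pi_part : is_partition pi).

Lemma partition_lt : {homo pi : j k / (j < k)%N >-> j < k}.
Proof. by case: pi_part => _ h _; apply: homo_ltn h; apply: lt_trans. Qed.

Lemma partition_le : {homo pi : j k / (j <= k)%N >-> j <= k}.
Proof.
move=> j k; rewrite leq_eqVlt => /orP[/eqP->//|/partition_lt]; exact: ltW.
Qed.

Lemma partition_ge0 k : 0 <= pi k.
Proof. by case: (pi_part) => <- _ _; apply: partition_le. Qed.

Lemma partition_cover t : 0 < t -> exists k, pi k < t <= pi k.+1.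
Proof.
case: (pi_part) => pi0 _ unb t_gt0.
have [k tk] : exists k, t <= pi k.
  apply: contrapT => /forallNP h; apply: unb; exists t => _ [k _ <-].
  by rewrite ltW// ltNge; apply/negP/h.
elim: k tk => [|k ih tk]; first by rewrite pi0 leNgt t_gt0.
by have [/ih//|kt] := leP t (pi k); exists k; rewrite kt tk.
Qed.

Lemma partition_index k t : pi k < t <= pi k.+1 ->
  xget 0%N [set k | pi k < t <= pi k.+1] = k.
Proof.
move=> kt; case: xgetP => [j _ /= jt|/(_ k)//].
have lem i l : pi i < t <= pi i.+1 -> pi l < t <= pi l.+1 -> (i <= l)%N.
  move=> /andP[it _] /andP[_ tl]; rewrite leqNgt; apply/negP => /partition_le.
  by move=> /(le_trans tl) /(lt_le_trans it); rewrite ltxx.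
by apply/eqP; rewrite eqn_leq !lem.
Qed.

Lemma euler_polygon_node k : euler_polygon g pi (pi k) = euler_node g pi k.
Proof.
rewrite /euler_polygon; case: k => [|k].
  by case: (pi_part) => -> _ _; rewrite lexx.
have kk : pi k < pi k.+1 <= pi k.+1 by rewrite partition_lt/=.
by rewrite leNgt (le_lt_trans (partition_ge0 k)) ?partition_lt//
  (partition_index kk).
Qed.

Lemma euler_polygon0 : euler_polygon g pi 0 = 0.
Proof. by rewrite /euler_polygon lexx. Qed.

Lemma euler_polygonS k t : pi k < t <= pi k.+1 ->
  euler_polygon g pi t =
  Num.max 0 (euler_polygon g pi (pi k) +
             (t - pi k) * g (pi k, euler_polygon g pi (pi k))).
Proof.
move=> kt; rewrite euler_polygon_node /euler_polygon (partition_index kt).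
by case/andP: kt => kt _; rewrite leNgt (le_lt_trans (partition_ge0 k) kt).
Qed.

End EulerPolygon.

(* Main.v *)
(** Since [g] increases strictly in time, a time shift creates slack: on a
    compact rectangle [g (t + d, x) >= g (t, x) + eta] with [eta > 0].  So if
    [u] and [v] start at [0] and have right slopes within [eta / 2] of
    [g (t, u t)] and [g (t, v t)], then [v] shifted by [d] is a supersolution
    for [u], whence [u t <= v (t + d)], and symmetrically; as both are
    Lipschitz with a common constant, [u] and [v] are uniformly close.  This
    one estimate gives uniqueness, continuous dependence and the convergence of
    the Euler polygons, whose limit is the solution.  A priori bounds come from
    levels [X] with [g (T, X) < 0], which cannot be crossed before time [T];
    taking the infimum over such levels gives the upper bound of the theorem. *)

Require Import Defs.
From mathcomp Require Import all_boot all_order all_algebra.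
From mathcomp Require Import all_classical all_reals all_analysis.
From mathcomp Require Import ring lra.
Import Order.TTheory GRing.Theory Num.Theory.
Import numFieldNormedType.Exports.
Local Open Scope classical_set_scope.
Local Open Scope ring_scope.

(** * Comparison of approximate solutions *)

(** The price is that two functions are compared at different times, so estimates on [[0, T]] use
    data on [[0, T + 1]], with shifts of at most 1. Existence needs no compactness for families of
    functions: polygons of two fine partitions are approximate solutions for the same field, so the
    stability estimate applied to the pair shows that they form a Cauchy sequence. Right slopes
    alone would not make the limit differentiable, so its increments are compared with the field at
    an arbitrary point of the interval, with an error uniform in the partition; this recovers left
    derivatives. The positive part in the Euler scheme is harmless because [g (t, 0) >= 0]: a
    segment is cut off only near 0, where the field is almost nonnegative. A discrete step might
    also jump over a level [X], so for polygons the barrier is thickened to a strip below [X], and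
    the mesh is adapted to its width. *)

Lemma at_right_ex {R : realType} (s : R) (P : R -> Prop) :
  (\forall t \near s^'+, P t) <->
  exists2 e : R, 0 < e & forall t, s < t < s + e -> P t.
Proof.
split=> [[e /= e0 H]|[e e0 H]].
  exists e => // t /andP[st te]; apply: H => //=.
  by rewrite distrC gtr0_norm ?subr_gt0// ltrBlDl.
near=> t; apply: H; apply/andP; split => //.
by near: t; apply: nbhs_right_lt; rewrite ltrDl.
Unshelve. all: by end_near. Qed.

Lemma at_left_ex {R : realType} (s : R) (P : R -> Prop) :
  (\forall t \near s^'-, P t) <->
  exists2 e : R, 0 < e & forall t, s - e < t < s -> P t.
Proof.
split=> [[e /= e0 H]|[e e0 H]].
  exists e => // t /andP[st te]; apply: H => //=.
  by rewrite gtr0_norm ?subr_gt0// ltrBlDl -ltrBlDr.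
near=> t; apply: H; apply/andP; split => //.
by near: t; apply: nbhs_left_gt; rewrite ltrBlDr ltrDl.
Unshelve. all: by end_near. Qed.

(** If [P] fails at [t1], let [s] be the supremum of the times up to which [P] holds throughout. The
    left hypothesis gives [P s], and the right one carries [P] beyond [s], a contradiction. *)
Lemma real_induction {R : realType} (a b : R) (P : R -> Prop) :
  P a ->
  (forall s, a <= s < b -> P s -> \forall t \near s^'+, P t) ->
  (forall s, a < s <= b -> (forall t, a <= t < s -> P t) -> P s) ->
  forall t, a <= t <= b -> P t.
Proof.
move=> Pa Pright Pleft t1 /andP[at1 t1b]; apply: contrapT => nPt1.
pose S := [set t | a <= t <= t1 /\ forall r, a <= r <= t -> P r].
have Sa : S a.
  by split; rewrite ?lexx// => r; rewrite -eq_le => /eqP <-.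
have ubS : ubound S t1 by move=> t [/andP[]].
have hS : has_sup S by split; [exists a | exists t1].
pose s := sup S.
have as_ : a <= s by apply: ub_le_sup => //; exists t1.
have st1 : s <= t1 by apply: ge_sup => //; exists a.
have Pr r : a <= r < s -> P r.
  move=> /andP[ar rs]; have [|x [_ Sx] rx] := @sup_gt _ S r _ rs.
    by exists a.
  by apply: Sx; rewrite ar ltW.
have Ps : P s.
  have [<-//|sa] := eqVneq a s; apply: Pleft => //.
  by rewrite lt_neqAle sa as_ (le_trans st1).
have slt : s < t1.
  by rewrite lt_neqAle st1 andbT; apply/eqP => E; apply: nPt1; rewrite -E.
have [|e e0 He] := (at_right_ex s P).1 (Pright s _ Ps).
  by rewrite as_ (lt_le_trans slt).
pose t := Num.min t1 (s + e / 2).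
have st : s < t by rewrite lt_min slt ltrDl divr_gt0.
have : S t.
  split; first by rewrite (le_trans as_ (ltW st)) ge_min lexx.
  move=> r /andP[ar rt]; have [rs|sr|->//] := ltgtP r s.
    by apply: Pr; rewrite ar.
  apply: He; rewrite sr (le_lt_trans rt)// gt_min; apply/orP; right.
  lra.
have : t <= s -> False by move=> /(lt_le_trans st); rewrite ltxx.
by move=> H St; apply: H; apply: ub_le_sup => //; exists t1.
Qed.

(** A strict inequality [u s < w s] persists to the right by right continuity, and [u <= w] passes
    to left limits; slopes therefore matter only where the two graphs touch. *)
Lemma le_of_contact {R : realType} (a b : R) (u w : R -> R) :
  u a <= w a ->
  (forall s, a <= s < b -> u t @[t --> s^'+] --> u s) ->
  (forall s, a < s <= b -> u t @[t --> s^'-] --> u s) ->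
  (forall s, a <= s < b -> w t @[t --> s^'+] --> w s) ->
  (forall s, a < s <= b -> w t @[t --> s^'-] --> w s) ->
  (forall s, a <= s < b -> u s = w s -> \forall t \near s^'+, u t <= w t) ->
  forall t, a <= t <= b -> u t <= w t.
Proof.
move=> uwa ur ul wr wl H; apply: real_induction => //.
  move=> s asb; rewrite le_eqVlt => /orP[/eqP|uws]; first exact: H.
  have uwr : (w t - u t) @[t --> s^'+] --> w s - u s.
    by apply: cvgB; [exact: wr|exact: ur].
  have : \forall t \near s^'+, 0 < w t - u t.
    by apply: (cvgr_gt _ uwr); rewrite subr_gt0.
  by apply: filterS => t; rewrite subr_gt0 => /ltW.
move=> s /[dup] /andP[as_ sb] asb h.
have uwl : (w t - u t) @[t --> s^'-] --> w s - u s.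
  by apply: cvgB; [exact: wl|exact: ul].
rewrite -subr_ge0; apply: (cvgr_to_ge uwl).
near=> t; rewrite subr_ge0; apply: h; apply/andP; split; last first.
  by near: t; exact: nbhs_left_lt.
by near: t; apply: nbhs_left_ge.
Unshelve. all: by end_near. Qed.
(* Only right slopes are controlled: an Euler polygon has one at every point,
   its nodes included. *)
Definition approx_solution {R : realType} (g : R * R -> R) (T eps : R)
    (u : R -> R) :=
  [/\ u 0 = 0,
      forall t, 0 <= t <= T -> 0 <= u t,
      forall s, 0 < s <= T -> u t @[t --> s^'-] --> u s &
      forall s, 0 <= s < T -> \forall t \near s^'+,
        `|u t - u s - (t - s) * g (s, u s)| <= eps * (t - s)].

(** A bound on the right slope forces right continuity, which is why [approx_solution] asks
    explicitly for left continuity only. *)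
Lemma right_cvg_of_slope {R : realType} (u : R -> R) (s c eps : R) :
  (\forall t \near s^'+, `|u t - u s - (t - s) * c| <= eps * (t - s)) ->
  u t @[t --> s^'+] --> u s.
Proof.
move=> H; apply/cvgrPdist_le => e e0.
have C0 : 0 < `|c| + `|eps| + 1.
  by rewrite ltr_wpDl// addr_ge0.
near=> t.
have st : s < t by near: t; exact: nbhs_right_gt.
have ts : t - s < e / (`|c| + `|eps| + 1).
  by near: t; apply: nbhs_right_ltDr; rewrite divr_gt0.
have H1 : `|u t - u s - (t - s) * c| <= eps * (t - s) by near: t.
have ts0 : 0 < t - s by rewrite subr_gt0.
rewrite distrC.
have -> : u t - u s = (u t - u s - (t - s) * c) + (t - s) * c by rewrite subrK.
apply: (le_trans (ler_normD _ _)).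
rewrite normrM (gtr0_norm ts0).
move: ts; rewrite ltr_pdivlMr// => /ltW; apply: le_trans.
have : eps * (t - s) <= `|eps| * (t - s) by apply: ler_wpM2r; [exact: ltW|exact: ler_norm].
by move=> H2; lra.
Unshelve. all: by end_near. Qed.

Lemma approx_right_cvg {R : realType} (g : R * R -> R) (T eps : R) u s :
  approx_solution g T eps u -> 0 <= s < T -> u t @[t --> s^'+] --> u s.
Proof. by move=> [_ _ _ H] /H; exact: right_cvg_of_slope. Qed.

Lemma approx_solution_le {R : realType} (g : R * R -> R) (T T' eps : R) u :
  T' <= T -> approx_solution g T eps u -> approx_solution g T' eps u.
Proof.
move=> T'T [u0 up ul ur]; split => //.
- by move=> t /andP[t0 tT]; apply: up; rewrite t0 (le_trans tT).
- by move=> t /andP[t0 tT]; apply: ul; rewrite t0 (le_trans tT).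
- by move=> t /andP[t0 tT]; apply: ur; rewrite t0 (lt_le_trans tT).
Qed.

Lemma affine_cvg {R : realType} (F : set_system R) {FF : Filter F}
  (y c a s : R) : F --> s -> (y + (t - a) * c) @[t --> F] --> y + (s - a) * c.
Proof.
move=> Fs; apply: cvgD; first exact: cvg_cst.
by apply: cvgM; [apply: cvgB => //; exact: cvg_cst|exact: cvg_cst].
Qed.

Lemma at_right_cvg_id {R : realType} (s : R) : s^'+ --> s.
Proof. exact: cvg_within. Qed.

Lemma at_left_cvg_id {R : realType} (s : R) : s^'- --> s.
Proof. exact: cvg_within. Qed.

(** Mean value inequality for one-sided slopes: [u] is trapped between the lines of slopes
    [c - (eps + e)] and [c + (eps + e)] through [(a, u a)]. *)
Lemma approx_increment {R : realType} (g : R * R -> R) (T eps c e a b : R) u :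
  approx_solution g T eps u -> 0 <= a -> a <= b -> b <= T ->
  (forall s, a <= s <= b -> `|g (s, u s) - c| <= e) ->
  `|u b - u a - (b - a) * c| <= (eps + e) * (b - a).
Proof.
move=> /[dup] Hu [u0 up ul ur] a0 ab bT Hc.
have ur' s : a <= s < b -> u t @[t --> s^'+] --> u s.
  move=> /andP[as_ sb]; apply: (approx_right_cvg _ _ _ _ _ Hu).
  by rewrite (le_trans a0)//= (lt_le_trans sb).
have ul' s : a < s <= b -> u t @[t --> s^'-] --> u s.
  move=> /andP[as_ sb]; apply: ul.
  by rewrite (le_lt_trans a0)//= (le_trans sb).
have bab : a <= b <= b by rewrite ab lexx.
have key s : a <= s < b -> \forall t \near s^'+,
    u s + (t - s) * (c - (eps + e)) <= u t <= u s + (t - s) * (c + (eps + e)).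
  move=> /andP[as_ sb].
  have H : 0 <= s < T by rewrite (le_trans a0)//= (lt_le_trans sb).
  have /Hc : a <= s <= b by rewrite as_ ltW.
  rewrite ler_norml => /andP[c1 c2].
  near=> t.
  have st : 0 <= t - s by rewrite subr_ge0; near: t; exact: nbhs_right_ge.
  have : `|u t - u s - (t - s) * g (s, u s)| <= eps * (t - s).
    by near: t; apply: ur.
  rewrite ler_norml => /andP[h1 h2].
  have m1 : (t - s) * - e <= (t - s) * (g (s, u s) - c) by rewrite ler_wpM2l.
  have m2 : (t - s) * (g (s, u s) - c) <= (t - s) * e by rewrite ler_wpM2l.
  by apply/andP; split; nra.
have Hup : u b <= u a + (b - a) * (c + (eps + e)).
  apply: (@le_of_contact _ a b u
    (fun t => u a + (t - a) * (c + (eps + e)))) => //.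
  - by rewrite subrr mul0r addr0.
  - by move=> s _; apply: affine_cvg; exact: at_right_cvg_id.
  - by move=> s _; apply: affine_cvg; exact: at_left_cvg_id.
  - move=> s /key; rewrite /= => K E; apply: filterS K => t /andP[_]; lra.
have Hlo : u a + (b - a) * (c - (eps + e)) <= u b.
  apply: (@le_of_contact _ a b
    (fun t => u a + (t - a) * (c - (eps + e))) u) => //.
  - by rewrite subrr mul0r addr0.
  - by move=> s _; apply: affine_cvg; exact: at_right_cvg_id.
  - by move=> s _; apply: affine_cvg; exact: at_left_cvg_id.
  - move=> s /key; rewrite /= => K E; apply: filterS K => t /andP[+ _]; lra.
by rewrite ler_norml; apply/andP; split; lra.
Unshelve. all: by end_near. Qed.

Lemma approx_lipschitz {R : realType} (g : R * R -> R) (T eps X C a b : R) u :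
  approx_solution g T eps u ->
  (forall t, 0 <= t <= T -> u t <= X) ->
  (forall t x, 0 <= t <= T -> 0 <= x <= X -> `|g (t, x)| <= C) ->
  0 <= a -> a <= b -> b <= T ->
  `|u b - u a| <= (eps + C) * (b - a).
Proof.
move=> /[dup] Hu [_ up _ _] uX gC a0 ab bT.
have := @approx_increment _ g T eps 0 C a b u Hu a0 ab bT.
rewrite mulr0 subr0; apply => s /andP[as_ sb].
have sT : 0 <= s <= T by rewrite (le_trans a0)//= (le_trans sb).
by rewrite subr0 gC// up// uX.
Qed.

(** At a contact time [u s = v (s + d)], so the slope of [u] is at most [g (s, u s) + eps] and that
    of the shifted [v] at least [g (s + d, u s) - eps]. Both involve the same second argument [u s],
    so a bound [X] on [u] is enough to apply the gap [eta]. *)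
Lemma approx_comparison {R : realType} (g : R * R -> R) (T eps X d eta : R) u v :
  0 <= d -> eps + eps <= eta ->
  (forall t x, 0 <= t <= T -> 0 <= x <= X -> g (t, x) + eta <= g (t + d, x)) ->
  approx_solution g T eps u -> approx_solution g (T + d) eps v ->
  (forall t, 0 <= t <= T -> u t <= X) ->
  forall t, 0 <= t <= T -> u t <= v (t + d).
Proof.
move=> d0 epseta gd /[dup] Hu [u0 up ul ur] /[dup] Hv [v0 vp vl vr] uX t tT.
have T0 : 0 <= T by case/andP: tT; exact: le_trans.
have vrd s : 0 <= s < T -> \forall t \near s^'+,
    `|v (t + d) - v (s + d) - (t - s) * g (s + d, v (s + d))| <= eps * (t - s).
  move=> /andP[s0 sT].
  have /vr /at_right_ex[h h0 H] : 0 <= s + d < T + d.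
    by rewrite addr_ge0//= ltrD2r.
  apply/at_right_ex; exists h => // r /andP[sr rh].
  have -> : r - s = (r + d) - (s + d) by lra.
  by apply: H; apply/andP; split; lra.
apply: (@le_of_contact _ 0 T u (fun t => v (t + d))) => //.
(* The shifted [v] starts at [v d >= 0 = u 0]: nonnegativity supplies the initial inequality. *)
- by rewrite add0r u0 vp// d0 lerDr.
- by move=> s; exact: approx_right_cvg Hu.
- by move=> s /vrd; exact: right_cvg_of_slope.
- move=> s /andP[s0 sT]; apply/cvgrPdist_le => e e0.
  have /vl /cvgrPdist_le : 0 < s + d <= T + d.
    by rewrite ltr_wpDr//= lerD2r.
  move=> /(_ e e0)/at_left_ex[h h0 H]; apply/at_left_ex; exists h => // r rs.
  by apply: H; apply/andP; split; lra.
- move=> s sT E.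
  have sT' : 0 <= s <= T by case/andP: sT => -> /ltW.
  near=> r.
  have sr : 0 <= r - s by rewrite subr_ge0; near: r; exact: nbhs_right_ge.
  have : `|u r - u s - (r - s) * g (s, u s)| <= eps * (r - s).
    by near: r; apply: ur.
  have : `|v (r + d) - v (s + d) - (r - s) * g (s + d, v (s + d))|
      <= eps * (r - s).
    by near: r; apply: vrd.
  have : g (s, u s) + eta <= g (s + d, u s) by apply: gd => //; rewrite up// uX.
  rewrite -E => h1; rewrite !ler_norml => /andP[h2 h3] /andP[h4 h5].
  have : (r - s) * (g (s, u s) + (eps + eps)) <= (r - s) * g (s + d, u s).
    by rewrite ler_wpM2l//; lra.
  by nra.
Unshelve. all: by end_near. Qed.

(** * Compactness estimates and stability *)

(** Only the first point is confined to the rectangle, the second ranges over the whole quadrant.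
    Taking [T] and [X] to be the coordinates of a point thus also gives plain continuity at that
    corner. *)
Lemma field_unif_cont {R : realType} (g : R * R -> R) (T X e : R) :
  {within Rplus2 R, continuous g} -> 0 < e ->
  exists2 d : R, 0 < d & forall t x s y,
    0 <= t <= T -> 0 <= x <= X -> 0 <= s -> 0 <= y ->
    `|t - s| <= d -> `|x - y| <= d -> `|g (t, x) - g (s, y)| <= e.
Proof.
move=> /subspace_continuousP gc e0.
pose K : set (R * R) := `[0, T] `*` `[0, X].
have cK : compact K by apply: compact_setX; exact: segment_compact.
pose P (d : R) (p : R * R) := forall q : R * R, 0 <= q.1 -> 0 <= q.2 ->
  `|p.1 - q.1| <= d -> `|p.2 - q.2| <= d -> `|g p - g q| <= e.
(* Compactness in covering form: it remains to find, around each point of [K], a neighbourhood and a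
   bound on [d] that work together. *)
have /(_ R (0^'+) P _) : near_covering_within K.
  by apply/near_covering_withinP; exact/compact_near_coveringP.
move=> H; have {}H : \forall d \near 0^'+, K `<=` P d.
  apply: H => p [/=]; rewrite !in_itv/= => /andP[p10 p1T] /andP[p20 p2X].
  have /gc/cvgrPdist_le/(_ (e / 2)) : Rplus2 R p by [].
  rewrite divr_gt0// => /(_ isT); rewrite near_withinE.
  move=> /nbhs_ballP[r /= r0 Hr].
  have r20 : 0 < r / 2 by rewrite divr_gt0.
  exists (ball p (r / 2), [set d | d < r / 2]).
    split; first exact: nbhsx_ballx.
    exact: nbhs_right_lt.
  move=> [q d] /= [[q1 q2] dr] [/=]; rewrite !in_itv/=.
  move=> /andP[q10 _] /andP[q20 _] z z10 z20 qz1 qz2.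
  have h1 : `|g p - g q| <= e / 2.
    apply: Hr => //; split => /=.
      by apply: (le_ball _ q1); rewrite ler_pdivrMr// ler_peMr ?ltW// ltr1n.
    by apply: (le_ball _ q2); rewrite ler_pdivrMr// ler_peMr ?ltW// ltr1n.
  have h2 : `|g p - g z| <= e / 2.
    apply: Hr => //; split => /=; rewrite -ball_normE/=.
      rewrite -(subrKA q.1) (le_lt_trans (ler_normD _ _))// (splitr r).
      by rewrite ltrD// (le_lt_trans qz1).
    rewrite -(subrKA q.2) (le_lt_trans (ler_normD _ _))// (splitr r).
    by rewrite ltrD// (le_lt_trans qz2).
  rewrite -(subrKA (g p)) (le_trans (ler_normD _ _))// (splitr e).
  by rewrite lerD// distrC.
near (0 : R)^'+ => d; exists d.
  by near: d; exact: nbhs_right_gt.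
move=> t x s y tT xX s0 y0 ts xy.
have /(_ (t, x) _ (s, y)) : K `<=` P d by near: d.
by apply => //; split => /=; rewrite in_itv.
Unshelve. all: by end_near. Qed.

Lemma field_bounded {R : realType} (g : R * R -> R) (T X : R) :
  {within Rplus2 R, continuous g} ->
  exists2 C : R, 0 < C &
    forall t x, 0 <= t <= T -> 0 <= x <= X -> `|g (t, x)| <= C.
Proof.
move=> gc; pose K : set (R * R) := `[0, T] `*` `[0, X].
have cK : compact K by apply: compact_setX; exact: segment_compact.
have KR : K `<=` Rplus2 R.
  by move=> p [/=]; rewrite !in_itv/= => /andP[? _] /andP[? _].
have /ex_strict_bound_gt0[C C0 HC] : bounded_set (g @` K).
  apply/compact_bounded/continuous_compact => //.
  exact: continuous_subspaceW gc.
exists C => // t x tT xX; by apply/ltW/HC; exists (t, x).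
Qed.

(** [eta] is the minimum over the compact rectangle of the continuous increment
    [g (t + d, x) - g (t, x)], positive at the minimiser by strict increase in time. *)
Lemma field_gap {R : realType} (g : R * R -> R) (T X d : R) :
  classG g -> 0 <= T -> 0 <= X -> 0 < d ->
  exists2 eta : R, 0 < eta &
    forall t x, 0 <= t <= T -> 0 <= x <= X -> g (t, x) + eta <= g (t + d, x).
Proof.
move=> [gc [_ gi _ _]] T0 X0 d0; pose K : set (R * R) := `[0, T] `*` `[0, X].
have cK : compact K by apply: compact_setX; exact: segment_compact.
pose f (p : R * R) := g (p.1 + d, p.2) - g p.
have fc : {within K, continuous f}.
  apply/subspace_continuousP => -[t x] [/=].
  rewrite !in_itv/= => /andP[t0 tT] /andP[x0 xX]; apply/cvgrPdist_le => e e0.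
  have e20 : 0 < e / 2 by rewrite divr_gt0.
  have [h h0 H] := field_unif_cont g (T + d) X _ gc e20.
  rewrite near_withinE; apply/nbhs_ballP; exists h => // -[s y] [/= ts xy] [/=].
  rewrite !in_itv/= => /andP[s0 sT] /andP[y0 yX].
  rewrite /f/= opprD opprK addrACA (le_trans (ler_normD _ _))//.
  have h1 : `|t - s| <= h by move: ts; rewrite -ball_normE/= => /ltW.
  have h2 : `|x - y| <= h by move: xy; rewrite -ball_normE/= => /ltW.
  rewrite (splitr e) lerD//.
    apply: H => /=.
    - by rewrite addr_ge0 ?(ltW d0)// lerD2r.
    - by rewrite x0.
    - by rewrite addr_ge0 ?(ltW d0).
    - exact: y0.
    - by rewrite opprD addrACA subrr addr0.
    - exact: h2.
  rewrite addrC distrC; apply: H => //=; rewrite ?t0 ?x0//=.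
  by rewrite (le_trans tT)// lerDl ltW.
have K0 : K !=set0 by exists (0, 0); split; rewrite /= in_itv/= lexx.
have [[t1 x1]] := compact_EVT_min K0 cK fc.
rewrite inE => -[/=]; rewrite !in_itv/= => /andP[t10 t1T] /andP[x10 x1X] H.
exists (f (t1, x1)).
  by rewrite subr_gt0; apply: gi => //=; rewrite ltrDl.
move=> t x tT xX; rewrite addrC -lerBrDr.
by apply: (H (t, x)); rewrite inE; split; rewrite /= in_itv.
Qed.

Lemma classG_neg {R : realType} (g : R * R -> R) (T : R) :
  classG g -> 0 <= T -> exists2 X : R, 0 < X & g (T, X) < 0.
Proof.
move=> [_ [g0 gi gn _]] T0.
have /ereal_inf_lt[_ [x /= x0 <-]] := gn _ T0.
rewrite lte_fin => gx; exists x => //; rewrite lt_neqAle x0 andbT eq_sym.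
(* The infimum condition only yields a level [x >= 0]; [x = 0] is excluded because
   [g (T, 0) >= g (0, 0) >= 0]. *)
apply/eqP => xE; move: gx; rewrite xE ltNge (le_trans g0)//.
by have [->//|TN0] := eqVneq T 0; apply/ltW/gi; rewrite // lt_neqAle eq_sym TN0.
Qed.

Lemma approx_stability {R : realType} (g : R * R -> R) (T X e : R) :
  classG g -> 0 <= T -> 0 <= X -> 0 < e ->
  exists2 eps : R, 0 < eps & forall u v : R -> R,
    approx_solution g (T + 1) eps u -> approx_solution g (T + 1) eps v ->
    (forall t, 0 <= t <= T + 1 -> u t <= X) ->
    (forall t, 0 <= t <= T + 1 -> v t <= X) ->
    forall t, 0 <= t <= T -> `|u t - v t| <= e.
Proof.
move=> gG T0 X0 e0; have [gc _] := gG.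
have [C C0 HC] := field_bounded g (T + 1) X gc.
(* The shift stays within the extra unit of time, and a function with Lipschitz constant [1 + C]
   moves by at most [e] during it. *)
pose d := Num.min 1 (e / (1 + C)).
have d0 : 0 < d by rewrite lt_min ltr01 divr_gt0// addr_gt0.
have d1 : d <= 1 by rewrite ge_min lexx.
have dC : (1 + C) * d <= e.
  by rewrite mulrC -ler_pdivlMr ?addr_gt0// ge_min lexx orbT.
have [eta eta0 Heta] := field_gap g T X d gG T0 X0 d0.
(* The cap at 1 makes [1 + C] a Lipschitz constant for every [eps]-approximate solution below [X],
   so [d] could be fixed before [eps]. *)
pose eps := Num.min 1 (eta / 2).
have eps0 : 0 < eps by rewrite lt_min ltr01 divr_gt0.
have eps1 : eps <= 1 by rewrite ge_min lexx.
have epseta : eps + eps <= eta.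
  by rewrite [leRHS]splitr lerD// ge_min lexx orbT.
exists eps => //.
suff key u v : approx_solution g (T + 1) eps u ->
    approx_solution g (T + 1) eps v ->
    (forall t, 0 <= t <= T + 1 -> u t <= X) ->
    (forall t, 0 <= t <= T + 1 -> v t <= X) ->
    forall t, 0 <= t <= T -> u t <= v t + e.
  move=> u v Hu Hv uX vX t tT; rewrite ler_norml.
  have := key _ _ Hu Hv uX vX _ tT; have := key _ _ Hv Hu vX uX _ tT.
  by move=> ? ?; apply/andP; split; lra.
move=> Hu Hv uX vX t tT.
have h1 : u t <= v (t + d).
  apply: (approx_comparison g T eps X d eta u v) => //; first exact: ltW.
  - by apply: approx_solution_le Hu; rewrite lerDl.
  - by apply: approx_solution_le Hv; rewrite lerD2l.
  - by move=> s /andP[s0 sT]; apply: uX; rewrite s0 (le_trans sT)// lerDl.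
have [t0 {}tT] := andP tT.
have : `|v (t + d) - v t| <= (eps + C) * (t + d - t).
  apply: (approx_lipschitz g _ eps X C _ _ v Hv) => //.
  - by rewrite lerDl ltW.
  - exact: lerD.
rewrite addrAC subrr add0r ler_norml => /andP[_ h2].
have : (eps + C) * d <= (1 + C) * d by rewrite ler_wpM2r ?lerD2r// ltW.
by move=> ?; lra.
Qed.

(** * Euler polygons *)

Lemma classG_ge0 {R : realType} (g : R * R -> R) (t : R) :
  classG g -> 0 <= t -> 0 <= g (t, 0).
Proof.
move=> [_ [g0 gi _ _]]; rewrite le_eqVlt => /orP[/eqP<-//|t0].
by apply: (le_trans g0); apply/ltW/gi.
Qed.

Lemma maxr0_lipschitz {R : realDomainType} (x y : R) :
  `|Num.max 0 x - Num.max 0 y| <= `|x - y|.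
Proof.
have [x0|x0] := lerP 0 x; have [y0|y0] := lerP 0 y => //.
- by rewrite subr0 !ger0_norm; lra.
- by rewrite sub0r normrN distrC !ger0_norm; lra.
- by rewrite subrr normr0.
Qed.

(* The positive part only modifies an increment when it cuts off the segment
   before [t]; then [- eps <= a < 0]. *)
Lemma maxr0_increment {R : realFieldType} (y a p s t eps : R) :
  0 <= y -> p <= s -> s <= t -> 0 <= eps ->
  (y + (t - p) * a < 0 -> - eps <= a) ->
  `|Num.max 0 (y + (t - p) * a) - Num.max 0 (y + (s - p) * a) - (t - s) * a|
    <= eps * (t - s).
Proof.
move=> y0 ps st eps0 Ha; have ts0 : 0 <= t - s by rewrite subr_ge0.
have ets : 0 <= eps * (t - s) by rewrite mulr_ge0.
have decomp : y + (t - p) * a = y + (s - p) * a + (t - s) * a by ring.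
have [yt|yt] := lerP 0 (y + (t - p) * a).
  have ys : 0 <= y + (s - p) * a.
    have [a0|a0] := lerP 0 a; first by rewrite addr_ge0 ?mulr_ge0 ?subr_ge0.
    have : (t - s) * a <= 0 by rewrite mulr_ge0_le0// ltW.
    by rewrite decomp in yt; lra.
  by rewrite max_r// decomp addrAC addrK subrr normr0.
have low : (t - s) * - a <= (t - s) * eps.
  by apply: ler_wpM2l => //; rewrite lerNl Ha.
have [ys|ys] := lerP 0 (y + (s - p) * a).
  by rewrite ler_norml; apply/andP; split; lra.
have : 0 <= (t - s) * - a.
  rewrite mulr_ge0// oppr_ge0 leNgt; apply/negP => a0.
  have : 0 <= y + (s - p) * a by rewrite addr_ge0// mulr_ge0 ?subr_ge0// ltW.
  by rewrite leNgt ys.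
by rewrite ler_norml => ?; apply/andP; split; lra.
Qed.

Lemma euler_node_ge0 {R : realType} (g : R * R -> R) (pi : nat -> R) k :
  0 <= euler_node g pi k.
Proof. by case: k => //= k; rewrite le_max lexx. Qed.

Lemma euler_polygon_piece {R : realType} (g : R * R -> R) (pi : nat -> R) k t :
  is_partition pi -> pi k <= t <= pi k.+1 ->
  euler_polygon g pi t =
  Num.max 0 (euler_node g pi k + (t - pi k) * g (pi k, euler_node g pi k)).
Proof.
move=> hpi /andP[]; rewrite le_eqVlt => /orP[/eqP<- _|kt tk].
  by rewrite euler_polygon_node// subrr mul0r addr0 max_r// euler_node_ge0.
by rewrite (@euler_polygonS _ _ _ _ k)// ?kt// euler_polygon_node.
Qed.

(** Intervals closed on the left, unlike those of [partition_cover]: at a node, the right slope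
    belongs to the segment that starts there and the left limit to the one that ends there. *)
Lemma partition_floor {R : realType} (pi : nat -> R) (s : R) :
  is_partition pi -> 0 <= s -> exists k, pi k <= s < pi k.+1.
Proof.
move=> /[dup] hpi [pi0 pilt _] s0.
have [] := eqVneq s 0 => [->|sN0].
  by exists 0%N; rewrite pi0 lexx/= -{1}pi0 pilt.
have [|k /andP[ks]] := partition_cover hpi (t := s).
  by rewrite lt_neqAle eq_sym sN0.
rewrite le_eqVlt => /orP[/eqP->|sk]; last by exists k; rewrite ltW.
by exists k.+1; rewrite lexx pilt.
Qed.

Lemma euler_approx {R : realType} (g : R * R -> R) (T X eps : R) :
  classG g -> 0 <= T -> 0 <= X -> g (T, X) < 0 -> 0 < eps ->
  exists2 mu : R, 0 < mu & forall pi : nat -> R, is_partition pi ->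
    (forall k t, pi k < t <= pi k.+1 -> t <= T -> t - pi k <= mu) ->
    approx_solution g T eps (euler_polygon g pi) /\
    forall t, 0 <= t <= T -> euler_polygon g pi t <= X.
Proof.
move=> /[dup] gG [gc [_ gi _ _]] T0 X0 gX eps0.
have eps20 : 0 < eps / 2 by rewrite divr_gt0.
have [d d0 Hd] := field_unif_cont g T X _ gc eps20.
have [C C0 HC] := field_bounded g T X gc.
have gX2 : 0 < - g (T, X) / 2 by rewrite divr_gt0// oppr_gt0.
have [d1 d10 Hd1] := field_unif_cont g T X _ gc gX2.
(* The bounds [d] and [d / C] keep the field within [eps / 2] of its node value along a segment, in
   time and in space; [d1 / C] keeps a step no longer than the width [d1] of the strip below [X]. *)
pose mu := Num.min d (Num.min (d / C) (d1 / C)).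
have mu0 : 0 < mu by rewrite !lt_min d0 !divr_gt0.
have mud : mu <= d by rewrite ge_min lexx.
have muCd : mu * C <= d by rewrite -ler_pdivlMr// !ge_min lexx orbT.
have muCd1 : mu * C <= d1 by rewrite -ler_pdivlMr// !ge_min lexx !orbT.
exists mu => // pi hpi hmesh.
(* In the strip [X - d1 <= y <= X] the field is negative at time [T], hence at all earlier times,
   and the step does not rise; from below the strip it climbs by at most [mu * C <= d1]. *)
have step s y h : 0 <= s <= T -> 0 <= y <= X -> 0 <= h <= mu ->
    Num.max 0 (y + h * g (s, y)) <= X.
  move=> sT yX /andP[h0 hmu]; rewrite ge_max X0/=.
  have [Xy|yX1] := lerP (X - d1) y.
    have TT : 0 <= T <= T by rewrite T0 lexx.
    have XX : 0 <= X <= X by rewrite X0 lexx.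
    have [s0 sT'] := andP sT; have [y0 yX'] := andP yX.
    have : `|g (T, X) - g (T, y)| <= - g (T, X) / 2.
      apply: Hd1 => //; first by rewrite subrr normr0 ltW.
      by rewrite ger0_norm; lra.
    rewrite ler_norml => /andP[gT _].
    have gs : g (s, y) <= g (T, y).
      move: sT'; rewrite le_eqVlt => /orP[/eqP->//|sT'].
      by apply/ltW/gi.
    have : h * - g (s, y) >= 0 by rewrite mulr_ge0//; lra.
    lra.
  have := HC _ _ sT yX; rewrite ler_norml => /andP[_ gC].
  have : h * g (s, y) <= h * C by rewrite ler_wpM2l.
  have : h * C <= mu * C by rewrite ler_wpM2r// ltW.
  by lra.
have pik0 k : 0 <= pi k by exact: partition_ge0.
have pilt k : pi k < pi k.+1 by exact: partition_lt.
have nodeX k : pi k <= T -> 0 <= euler_node g pi k <= X.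
  rewrite euler_node_ge0/=; elim: k => //= k ih kT.
  have kT' : pi k <= T by rewrite (le_trans _ kT)// ltW.
  apply: step; rewrite ?pik0//= ?euler_node_ge0 ?ih//.
  by rewrite subr_ge0 ltW//= hmesh// pilt lexx.
have tmu k t : pi k <= t <= pi k.+1 -> t <= T -> 0 <= t - pi k <= mu.
  move=> /andP[kt tk] tT; rewrite subr_ge0 kt/=.
  move: kt; rewrite le_eqVlt => /orP[/eqP->|kt]; first by rewrite subrr ltW.
  by apply: hmesh => //; rewrite kt.
have uX t : 0 <= t <= T -> 0 <= euler_polygon g pi t <= X.
  move=> /andP[t0 tT]; have [k /andP[kt tk]] := partition_floor _ _ hpi t0.
  have ktk : pi k <= t <= pi k.+1 by rewrite kt ltW.
  rewrite (euler_polygon_piece _ _ _ _ hpi ktk) le_max lexx/=.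
  apply: step; [|apply: nodeX|exact: tmu]; rewrite ?pik0//= (le_trans kt)//.
split; last by move=> t /uX/andP[].
split.
- exact: euler_polygon0.
- by move=> t /uX/andP[].
- move=> s /andP[s0 sT]; have [k /andP[ks sk]] := partition_cover hpi s0.
  apply/cvgrPdist_le => e e0.
  set y := euler_node g pi k.
  have H : \forall t \near s^'-,
      `|y + (s - pi k) * g (pi k, y) - (y + (t - pi k) * g (pi k, y))| <= e.
    have : (y + (t - pi k) * g (pi k, y)) @[t --> s^'-] -->
        y + (s - pi k) * g (pi k, y).
      by apply: affine_cvg; exact: at_left_cvg_id.
    by move/cvgrPdist_le; apply.
  near=> t.
  rewrite (euler_polygon_piece _ _ k s hpi) ?(ltW ks)//.
  rewrite (euler_polygon_piece _ _ k t hpi); last first.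
    apply/andP; split; first by near: t; exact: nbhs_left_ge.
    by rewrite (le_trans _ sk)//; near: t; exact: nbhs_left_le.
  by rewrite (le_trans (maxr0_lipschitz _ _))//; near: t; exact: H.
- move=> s /andP[s0 sT]; have [k /andP[ks sk]] := partition_floor _ _ hpi s0.
  have kT : pi k <= T by rewrite (le_trans ks) ?ltW.
  have ksk : pi k <= s <= pi k.+1 by rewrite ks ltW.
  have sT' : 0 <= s <= T by rewrite s0 ltW.
  have /andP[us0 usX] := uX _ sT'.
  have /andP[uk0 ukX] := nodeX _ kT.
  set y := euler_node g pi k in uk0 ukX *.
  have us : euler_polygon g pi s = Num.max 0 (y + (s - pi k) * g (pi k, y)).
    by rewrite (euler_polygon_piece _ _ k s hpi).
  have pT : 0 <= pi k <= T by rewrite pik0.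
  have yX : 0 <= y <= X by rewrite uk0.
  have gC := HC _ _ pT yX.
  have /andP[ks0 ksmu] := tmu _ _ ksk (ltW sT).
  (* Half of [eps] pays for freezing the field at the node, the other half for taking the positive
     part. *)
  have close : `|g (pi k, y) - g (s, euler_polygon g pi s)| <= eps / 2.
    apply: Hd => //.
      by rewrite distrC ger0_norm// (le_trans ksmu).
    rewrite -{1}(max_r uk0) us (le_trans (maxr0_lipschitz _ _))//.
    rewrite opprD addrA subrr sub0r normrN normrM ger0_norm//.
    by rewrite (le_trans _ muCd)// ler_pM.
  near=> t.
  have st : s < t by near: t; exact: nbhs_right_gt.
  have tT : t <= T by near: t; exact: nbhs_right_le.
  have tk : t <= pi k.+1 by near: t; exact: nbhs_right_le.
  have ktk : pi k <= t <= pi k.+1 by rewrite (le_trans ks) ?ltW.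
  have /andP[kt0 ktmu] := tmu _ _ ktk tT.
  have ut : euler_polygon g pi t = Num.max 0 (y + (t - pi k) * g (pi k, y)).
    by rewrite (euler_polygon_piece _ _ k t hpi).
  have incr : `|euler_polygon g pi t - euler_polygon g pi s -
      (t - s) * g (pi k, y)| <= eps / 2 * (t - s).
    rewrite ut us; apply: maxr0_increment => //; try exact: ltW; move=> yt.
    (* A segment is cut off only if it starts within [mu * C] of 0, where the field is close to
       [g (pi k, 0) >= 0]. *)
    have yd : y <= d.
      have : (t - pi k) * - g (pi k, y) <= mu * C.
        rewrite (le_trans (ler_norm _))// normrM normrN (ger0_norm kt0).
        by rewrite ler_pM.
      by clear -yt muCd; lra.
    have : `|g (pi k, y) - g (pi k, 0)| <= eps / 2.
      apply: Hd => //; first by rewrite subrr normr0 ltW.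
      by rewrite subr0 ger0_norm.
    rewrite ler_norml => /andP[ga _].
    have g0 := classG_ge0 g _ gG (pik0 k).
    by clear -ga g0; lra.
  have : `|(t - s) * (g (pi k, y) - g (s, euler_polygon g pi s))|
      <= (t - s) * (eps / 2).
    have ts0 : 0 <= t - s by rewrite subr_ge0 ltW.
    by rewrite normrM ger0_norm// ler_wpM2l.
  move: incr; rewrite !ler_norml => /andP[i1 i2] /andP[h1 h2].
  by clear -i1 i2 h1 h2; apply/andP; split; lra.
Unshelve. all: by end_near. Qed.

(** * Exact solutions *)

Lemma has_derivative_withinP {R : realType} (D : set R) (f : R -> R) (t l : R) :
  has_derivative_within D f t l <->
  forall e, 0 < e -> exists2 h : R, 0 < h &
    forall s, D s -> `|s - t| < h -> `|f s - f t - (s - t) * l| <= e * `|s - t|.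
Proof.
have slopeE s : s != t ->
    f s - f t - (s - t) * l = (s - t) * ((s - t)^-1 * (f s - f t) - l).
  by move=> st; rewrite mulrBr mulVKf// subr_eq0.
split=> [/cvgrPdist_le H e e0|H].
  have := H e e0; rewrite near_withinE near_withinE.
  move=> /nbhs_ballP[h /= h0 Hh]; exists h => // s Ds sth.
  have [->|st] := eqVneq s t; first by rewrite !subrr mul0r subrr normr0 mulr0.
  rewrite slopeE// normrM mulrC ler_wpM2r// distrC; apply: Hh => //.
  by rewrite -ball_normE/= distrC.
apply/cvgrPdist_le => e e0; have [h h0 Hh] := H e e0.
rewrite near_withinE near_withinE; apply/nbhs_ballP; exists h => // s.
rewrite -ball_normE/= distrC => sth st Ds.
have := Hh s Ds sth; rewrite slopeE// normrM mulrC distrC.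
by rewrite ler_pM2r// normr_gt0 subr_eq0.
Qed.

Lemma has_derivative_within_cvg {R : realType} (D : set R) (f : R -> R)
    (t l : R) :
  has_derivative_within D f t l -> f s @[s --> within D (nbhs t)] --> f t.
Proof.
move=> /has_derivative_withinP/(_ 1 ltr01)[h h0 H].
apply/cvgrPdist_le => e e0; have l0 : 0 < 1 + `|l| by rewrite ltr_pwDl.
rewrite near_withinE; apply/nbhs_ballP.
exists (Num.min h (e / (1 + `|l|))); first by rewrite /= lt_min h0 divr_gt0.
move=> s; rewrite -ball_normE/= lt_min distrC => /andP[sth ste] Ds.
have := H s Ds sth; rewrite mul1r => H1.
rewrite distrC -(subrK ((s - t) * l) (f s - f t)).
rewrite (le_trans (ler_normD _ _))// normrM.
move: ste; rewrite ltr_pdivlMr// => /ltW; apply: le_trans.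
by rewrite mulrDr mulr1 lerD2r.
Qed.

Lemma before_pinfty {R : realType} : before (+oo%E : \bar R) = Rplus R.
Proof.
by apply/seteqP; split => t /= => [[]//|t0]; split => //; exact: ltry.
Qed.

(** Solutions are recast as approximate ones of every tolerance, so that all the estimates above
    apply to them directly. *)
Definition exact_solution {R : realType} (g : R * R -> R) (T : R)
    (u : R -> R) := forall eps, 0 < eps -> approx_solution g T eps u.

Lemma maximal_solution_exact {R : realType} (g : R * R -> R) (T' : \bar R)
    (phi : R -> R) (T : R) :
  maximal_solution g T' phi -> (T%:E < T')%E -> exact_solution g T phi.
Proof.
move=> [_ [_ phi_ge0] phi0 dphi _] TT' eps eps0.
have before_le t : 0 <= t <= T -> before T' t.
  by move=> /andP[t0 tT]; split => //; rewrite (le_lt_trans _ TT')// lee_fin.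
split => //.
- by move=> t /before_le; exact: phi_ge0.
- move=> s /andP[s0 sT]; have sT' : 0 <= s <= T by rewrite ltW.
  have := has_derivative_within_cvg _ _ _ _ (dphi _ (before_le _ sT')).
  move=> /cvgrPdist_le H; apply/cvgrPdist_le => e e0.
  have := at_left_cvg_id s _ (H e e0); apply: filter_app; near=> t; apply.
  have ts : t <= s by near: t; exact: nbhs_left_le.
  apply: before_le; rewrite (le_trans ts)// andbT.
  by near: t; exact: nbhs_left_ge.
- move=> s /andP[s0 sT]; have sT' : 0 <= s <= T by rewrite s0 ltW.
  have /dphi/has_derivative_withinP/(_ eps eps0)[h h0 H] := before_le _ sT'.
  near=> t.
  have ts : s < t by near: t; exact: nbhs_right_gt.
  have tT : t <= T by near: t; exact: nbhs_right_le.
  have th : t - s < h by near: t; exact: nbhs_right_ltDr.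
  have ts0 : 0 < t - s by rewrite subr_gt0.
  have tT' : 0 <= t <= T by rewrite (le_trans s0 (ltW ts)).
  by have := H t (before_le _ tT'); rewrite (gtr0_norm ts0); apply.
Unshelve. all: by end_near. Qed.

Lemma exact_solution_le {R : realType} (g : R * R -> R) (S T X : R) u :
  classG g -> exact_solution g S u -> S <= T -> 0 <= X -> g (T, X) < 0 ->
  forall t, 0 <= t <= S -> u t <= X.
Proof.
move=> [_ [_ gi _ _]] Hu ST X0 gX.
have [u0 up ul ur] := Hu 1 ltr01.
apply: (@le_of_contact _ 0 S u (fun=> X)).
- by rewrite u0.
- by move=> s; apply: (approx_right_cvg g S 1); exact: Hu.
- exact: ul.
- by move=> s _; exact: cvg_cst.
- by move=> s _; exact: cvg_cst.
- move=> s /[dup] sS /andP[s0 sS'] us.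
  have gs : g (s, X) < 0 by apply: lt_trans gX; apply: gi; rewrite // (lt_le_trans sS').
  (* With tolerance [- g (s, X)], the upper slope estimate at a contact point reads exactly
     [u t <= X]. *)
  have [|_ _ _ /(_ s sS)] := Hu (- g (s, X)); first by rewrite oppr_gt0.
  rewrite us; apply: filterS => t; rewrite ler_norml => /andP[_]; lra.
Qed.

(** The comparison is applied to [u] and its own shift by [t - s]. *)
Lemma exact_solution_nondecreasing {R : realType} (g : R * R -> R) u :
  classG g -> (forall T, exact_solution g T u) ->
  forall s t, 0 <= s -> s <= t -> u s <= u t.
Proof.
move=> gG Hu s t s0; rewrite le_eqVlt => /orP[/eqP->//|st].
have [X X0 gX] := classG_neg g s gG s0.
have ts0 : 0 < t - s by rewrite subr_gt0.
have [eta eta0 Heta] := field_gap g s X (t - s) gG s0 (ltW X0) ts0.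
have eta20 : 0 < eta / 2 by rewrite divr_gt0.
rewrite -[t](subrK s) [X in _ <= u X]addrC.
apply: (approx_comparison g s (eta / 2) X (t - s) eta u u) => //.
- exact: ltW.
- by rewrite -splitr.
- exact: Hu.
- exact: Hu.
- exact: (exact_solution_le g s s X u gG (Hu s) (lexx s) (ltW X0) gX).
- by rewrite s0 lexx.
Qed.

(** If [u s = u t], then [u] is constant on [[s, t]], so [g (r, u s) = 0] for all [r] in [[s, t)],
    against strict increase of the field in time. *)
Lemma exact_solution_increasing {R : realType} (g : R * R -> R) u :
  classG g -> (forall T, exact_solution g T u) -> strictly_increasing u.
Proof.
move=> gG Hu s t s0 st.
have mono := exact_solution_nondecreasing g u gG Hu.
rewrite lt_neqAle (mono s t s0 (ltW st)) andbT; apply/eqP => ust.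
have const r : s <= r <= t -> u r = u s.
  move=> /andP[sr rt]; apply/eqP; rewrite eq_le (mono s r s0 sr) andbT.
  by rewrite ust; apply: mono => //; exact: le_trans sr.
have slope0 r : s <= r < t -> g (r, u s) = 0.
  move=> /andP[sr rt]; apply/eqP; rewrite -normr_eq0 eq_le normr_ge0 andbT.
  apply/ler_addgt0Pl => e e0; rewrite addr0.
  have [_ _ _ /(_ r)] := Hu t e e0.
  rewrite (le_trans s0 sr) rt => /(_ isT) H.
  near r^'+ => q.
  have rq : r < q by near: q; exact: nbhs_right_gt.
  have qt : q <= t by near: q; exact: nbhs_right_le.
  have : `|u q - u r - (q - r) * g (r, u r)| <= e * (q - r) by near: q.
  have qr0 : 0 < q - r by rewrite subr_gt0.
  rewrite !const ?sr ?(ltW rt) ?qt ?(le_trans sr (ltW rq))//.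
  by rewrite subrr sub0r normrN normrM (gtr0_norm qr0) mulrC ler_pM2r.
have [_ [_ gi _ _]] := gG.
have us0 : 0 <= u s by have [_ up _ _] := Hu s 1 ltr01; rewrite up// s0 lexx.
have : g (s, u s) < g ((s + t) / 2, u s) by apply: gi => //; lra.
by rewrite !slope0 ?ltxx//; apply/andP; split; lra.
Unshelve. all: by end_near. Qed.

Lemma exact_solution_unique {R : realType} (g : R * R -> R) u v :
  classG g -> (forall T, exact_solution g T u) ->
  (forall T, exact_solution g T v) -> forall t, 0 <= t -> u t = v t.
Proof.
move=> gG Hu Hv t t0; apply/eqP; rewrite -subr_eq0 -normr_eq0 eq_le normr_ge0.
rewrite andbT; apply/ler_addgt0Pl => e e0; rewrite addr0.
have t10 : 0 <= t + 1 by rewrite addr_ge0.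
have [X X0 gX] := classG_neg g _ gG t10.
have [eps eps0 H] := approx_stability g t X e gG t0 (ltW X0) e0.
apply: (H u v); rewrite ?t0 ?lexx//; try exact: Hu; try exact: Hv.
  exact: (exact_solution_le g _ _ X u gG (Hu _) (lexx _) (ltW X0) gX).
exact: (exact_solution_le g _ _ X v gG (Hv _) (lexx _) (ltW X0) gX).
Qed.

(* As [u] increases to [L], its slope stays above [g (T1, _)] near [L], which
   is positive for [T1] large. *)
Lemma exact_solution_unbounded {R : realType} (g : R * R -> R) u :
  classG g -> (forall T, exact_solution g T u) -> unbounded u.
Proof.
move=> gG Hu ubd; have mono := exact_solution_nondecreasing g u gG Hu.
have up t : 0 <= t -> 0 <= u t.
  by move=> t0; have [_ up _ _] := Hu t 1 ltr01; rewrite up// t0 lexx.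
have [gc [_ gi _ gp]] := gG.
have [B HB] : exists B, forall t, 0 <= t -> u t <= B.
  have [M [_ HM]] := ubd; exists (M + 1) => t t0.
  by rewrite (le_trans (ler_norm _))// (HM (M + 1))// ltrDl.
have hS : has_sup (u @` Rplus R).
  split; first by exists (u 0); exists 0 => //=; rewrite /Rplus/= lexx.
  by exists B => _ [t t0 <-]; exact: HB.
pose L := sup (u @` Rplus R).
have uL t : 0 <= t -> u t <= L by move=> t0; apply: sup_upper_bound => //; exists t.
have L0 : 0 <= L by rewrite (le_trans (up _ (lexx 0)))// uL.
have /ereal_sup_gt[_ [T1 /= T10 <-]] := gp _ L0; rewrite lte_fin => gT1.
have gT12 : 0 < g (T1, L) / 2 by rewrite divr_gt0.
have [d d0 Hd] := field_unif_cont g T1 L _ gc gT12.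
have [_ [T2 /= T20 <-] uT2] := sup_adherent d0 hS.
pose T3 := Num.max T1 T2.
have T30 : 0 <= T3 by rewrite le_max T10.
have slope s : T3 <= s -> g (T1, L) / 2 <= g (s, u s).
  move=> Ts; have s0 : 0 <= s by rewrite (le_trans T30).
  have [T1s T2s] : T1 <= s /\ T2 <= s.
    by move: Ts; rewrite /T3 ge_max => /andP[].
  have : `|g (T1, L) - g (T1, u s)| <= g (T1, L) / 2.
    apply: Hd; rewrite ?lexx ?L0 ?T10 ?subrr ?normr0 ?(ltW d0)//; first exact: up.
    rewrite ger0_norm ?subr_ge0 ?uL//.
    have : u T2 <= u s by exact: mono.
    by rewrite -/L in uT2; lra.
  rewrite ler_norml => /andP[_ h1].
  have : g (T1, u s) <= g (s, u s).
    move: T1s; rewrite le_eqVlt => /orP[/eqP->//|T1s].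
    by apply/ltW/gi => //; exact: up.
  by lra.
(* Half the lower bound on the slope: a tolerance of [c] still leaves growth at rate [c]. The time
   [b] is where the line of slope [c] has gained [L + 1]. *)
pose c := g (T1, L) / 4; have c0 : 0 < c by rewrite divr_gt0.
pose b := T3 + (L + 1) / c.
have Tb : T3 <= b by rewrite lerDl divr_ge0 ?addr_ge0// ltW.
have bb : T3 <= b <= b by rewrite Tb lexx.
have : u T3 + (b - T3) * c <= u b.
  have [_ _ ul _] := Hu b 1 ltr01.
  apply: (@le_of_contact _ T3 b (fun t => u T3 + (t - T3) * c) u) => //.
  - by rewrite subrr mul0r addr0.
  - by move=> s _; apply: affine_cvg; exact: at_right_cvg_id.
  - by move=> s _; apply: affine_cvg; exact: at_left_cvg_id.
  - move=> s /andP[s0 sb]; apply: (approx_right_cvg g b 1); first exact: Hu.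
    by rewrite (le_trans T30).
  - by move=> s /andP[s0 sb]; apply: ul; rewrite sb (le_lt_trans T30).
  - move=> s /andP[s0 sb] us.
    have [_ _ _ /(_ s)] := Hu b c c0.
    rewrite sb (le_trans T30)// => /(_ isT) H; near=> t.
    have st : 0 <= t - s by rewrite subr_ge0; near: t; exact: nbhs_right_ge.
    have : `|u t - u s - (t - s) * g (s, u s)| <= c * (t - s) by near: t.
    rewrite ler_norml => /andP[h1 _].
    have h2 := slope s s0.
    have : (t - s) * (c + c) <= (t - s) * g (s, u s).
      by apply: ler_wpM2l => //; rewrite /c; lra.
    by move: us; lra.
rewrite /b addrAC subrr add0r divfK ?gt_eqF// leNgt => /negP; apply.
rewrite (le_lt_trans (uL b _))//; first by rewrite (le_trans T30).
by have := up _ T30; lra.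
Unshelve. all: by end_near. Qed.

(** With a finite lifespan [r], a level [X] such that [g (r, X) < 0] would bound [psi] on all of
    [[0, r)], so neither [r] nor the supremum could be infinite. *)
Lemma maximal_solution_global {R : realType} (g : R * R -> R) (T : \bar R) psi :
  classG g -> maximal_solution g T psi -> T = +oo%E.
Proof.
move=> gG /[dup] Hpsi [T0 [_ psi0] _ _ Hmax].
case: T T0 Hpsi psi0 Hmax => [r|//|//] r0 Hpsi psi0 Hmax.
rewrite lte_fin in r0.
have [X X0 gX] := classG_neg g r gG (ltW r0).
have : (maxe r%:E (ereal_sup [set `|psi t|%:E | t in before r%:E])
    <= maxe r%:E X%:E)%E.
  rewrite ge_max le_max lexx/= le_max; apply/orP; right.
  apply: ge_ereal_sup => _ [t /[dup] bt [t0 tr] <-].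
  rewrite lee_fin ger0_norm ?psi0//; rewrite lte_fin in tr.
  apply: (exact_solution_le g t r X psi gG _ (ltW tr) (ltW X0) gX).
    exact: maximal_solution_exact Hpsi _.
  by rewrite t0 lexx.
by rewrite Hmax leye_eq -EFin_max.
Qed.

(** * Existence *)

Lemma euler_polygon_cvg {R : realType} (g : R * R -> R) (T e : R) u :
  classG g -> (forall S, exact_solution g S u) -> 0 <= T -> 0 < e ->
  exists2 mu : R, 0 < mu & forall pi : nat -> R, is_partition pi ->
    (forall k t, pi k < t <= pi k.+1 -> t <= T + 1 -> t - pi k <= mu) ->
    forall t, 0 <= t <= T -> `|u t - euler_polygon g pi t| <= e.
Proof.
move=> gG Hu T0 e0; have T10 : 0 <= T + 1 by rewrite addr_ge0.
have [X X0 gX] := classG_neg g _ gG T10.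
have [eps eps0 H] := approx_stability g T X e gG T0 (ltW X0) e0.
have [mu mu0 Hmu] := euler_approx g _ X eps gG T10 (ltW X0) gX eps0.
exists mu => // pi hpi hmesh; have [Ha HX] := Hmu _ hpi hmesh.
apply: H => //; first exact: Hu.
exact: (exact_solution_le g _ _ X u gG (Hu _) (lexx _) (ltW X0) gX).
Qed.

(** This brings solutions of a nearby field into [approx_stability], where both functions refer to
    the same field. *)
Lemma approx_perturb {R : realType} (g g1 : R * R -> R) (T eps e : R) u :
  approx_solution g1 T eps u ->
  (forall t, 0 <= t < T -> `|g1 (t, u t) - g (t, u t)| <= e) ->
  approx_solution g T (eps + e) u.
Proof.
move=> [u0 up ul ur] He; split => // s sT; have h := He s sT.
have H := ur s sT; near=> t.
have st : 0 <= t - s by rewrite subr_ge0; near: t; exact: nbhs_right_ge.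
have -> : u t - u s - (t - s) * g (s, u s) =
  (u t - u s - (t - s) * g1 (s, u s)) + (t - s) * (g1 (s, u s) - g (s, u s)).
  by rewrite mulrBr addrA subrK.
rewrite (le_trans (ler_normD _ _))// [leRHS]mulrDl lerD//; first by near: t.
by rewrite normrM ger0_norm// mulrC ler_wpM2r.
Unshelve. all: by end_near. Qed.

Lemma exact_solution_stability {R : realType} (g : R * R -> R) (T e : R) u :
  classG g -> (forall S, exact_solution g S u) -> 0 <= T -> 0 < e ->
  exists N : nat, exists2 eta : R, 0 < eta &
    forall (g1 : R * R -> R) (u1 : R -> R),
      classG g1 -> (forall S, exact_solution g1 S u1) ->
      (forall t x, 0 <= t <= N%:R -> 0 <= x <= N%:R ->
        `|g (t, x) - g1 (t, x)| <= eta) ->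
      forall t, 0 <= t <= T -> `|u t - u1 t| <= e.
Proof.
move=> gG Hu T0 e0; have T10 : 0 <= T + 1 by rewrite addr_ge0.
have [X X0 gX] := classG_neg g _ gG T10.
have [eps eps0 H] := approx_stability g T X e gG T0 (ltW X0) e0.
pose N := Num.bound (Num.max (T + 1) X).
have [TN XN] : T + 1 <= N%:R /\ X <= N%:R.
  have : Num.max (T + 1) X <= N%:R.
    by rewrite ltW// archi_boundP// le_max T10.
  by rewrite ge_max => /andP.
have eps20 : 0 < eps / 2 by rewrite divr_gt0.
(* The first bound keeps the perturbed solution [eps]-approximate for [g]; the second keeps
   [g1 (T + 1, X)] negative, so that [X] is a barrier for both fields. *)
pose eta := Num.min (eps / 2) (- g (T + 1, X) / 2).
have eta0 : 0 < eta by rewrite lt_min eps20 divr_gt0// oppr_gt0.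
exists N, eta => // g1 u1 g1G Hu1 gg1.
have g1X : g1 (T + 1, X) < 0.
  have : `|g (T + 1, X) - g1 (T + 1, X)| <= eta.
    by apply: gg1; rewrite ?T10 ?(ltW X0).
  have : eta <= - g (T + 1, X) / 2 by rewrite ge_min lexx orbT.
  by rewrite ler_norml => h1 /andP[h2 h3]; lra.
have u1X := exact_solution_le g1 _ _ X u1 g1G (Hu1 (T + 1)) (lexx _) (ltW X0) g1X.
apply: H => //; first exact: Hu.
  rewrite (splitr eps); apply: (approx_perturb g g1); first exact: Hu1.
  move=> t /andP[t0 tT]; have tT' : 0 <= t <= T + 1 by rewrite t0 ltW.
  have [_ u1p _ _] := Hu1 (T + 1) 1 ltr01.
  rewrite distrC (@le_trans _ _ eta)//; last by rewrite ge_min lexx.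
  apply: gg1; first by rewrite t0 (le_trans (ltW tT)).
  by rewrite u1p// (le_trans (u1X t _)).
exact: (exact_solution_le g _ _ X u gG (Hu _) (lexx _) (ltW X0) gX).
Qed.

Definition uniform_partition (R : realType) (n k : nat) : R := k%:R / n.+1%:R.

Lemma uniform_partitionP {R : realType} n : is_partition (uniform_partition R n).
Proof.
split=> [|k|[M HM]]; first by rewrite /uniform_partition mul0r.
  by rewrite ltr_pM2r ?invr_gt0// ltr_nat.
pose k := (Num.bound (Num.max 0 M)%R * n.+1)%N.
have := HM (uniform_partition R n k) (ex_intro2 _ _ k I erefl).
rewrite /uniform_partition /k natrM mulfK// leNgt => /negP; apply.
have : Num.max 0 M < (Num.bound (Num.max 0 M))%:R.
  by rewrite archi_boundP// le_max lexx.
by rewrite gt_max => /andP[].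
Qed.

Lemma uniform_partition_mesh {R : realType} (mu : R) : 0 < mu ->
  \forall n \near \oo, forall k t,
    uniform_partition R n k < t <= uniform_partition R n k.+1 ->
    t - uniform_partition R n k <= mu.
Proof.
move=> mu0; near=> n; move=> k t /andP[_ tk].
rewrite (@le_trans _ _ n.+1%:R^-1)//.
  rewrite lerBlDr (le_trans tk)// /uniform_partition -addn1 natrD mulrDl mul1r.
  by rewrite addrC.
by apply: ltW; near: n; exact: near_infty_natSinv_lt (PosNum mu0).
Unshelve. all: by end_near. Qed.

Lemma uniform_polygon_cvg {R : realType} (g : R * R -> R) (t : R) :
  classG g -> 0 <= t ->
  cvgn (fun n => euler_polygon g (uniform_partition R n) t).
Proof.
move=> gG t0; apply/cauchy_cvgP; apply: cauchy_exP => e e0.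
have e20 : 0 < e / 2 by rewrite divr_gt0.
have t10 : 0 <= t + 1 by rewrite addr_ge0.
have [X X0 gX] := classG_neg g _ gG t10.
have [eps eps0 H] := approx_stability g t X (e / 2) gG t0 (ltW X0) e20.
have [mu mu0 Hmu] := euler_approx g _ X eps gG t10 (ltW X0) gX eps0.
have [N _ HN] := uniform_partition_mesh mu mu0.
have close n : (N <= n)%N ->
    approx_solution g (t + 1) eps (euler_polygon g (uniform_partition R n)) /\
    forall s, 0 <= s <= t + 1 ->
      euler_polygon g (uniform_partition R n) s <= X.
  move=> /HN/= Hn; apply: Hmu; first exact: uniform_partitionP.
  by move=> k s ks _; exact: Hn.
exists (euler_polygon g (uniform_partition R N) t); exists N => // n /= Nn.
have [HaN HXN] := close N (leqnn N); have [Han HXn] := close n Nn.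
rewrite -ball_normE/= (@le_lt_trans _ _ (e / 2))//.
  by apply: H => //; rewrite t0 lexx.
by rewrite ltr_pdivrMr// ltr_pMr// ltr1n.
Qed.

(** The estimate holds for fine polygons with [h] independent of [n] and survives the pointwise
    limit. The choices [r = a] and [r = b] give the right and the left derivative of the limit. *)
Lemma euler_limit_increment {R : realType} (g : R * R -> R) (phi : R -> R)
    (T e : R) :
  classG g -> 0 <= T -> 0 < e ->
  (forall t, 0 <= t ->
    euler_polygon g (uniform_partition R n) t @[n --> \oo] --> phi t) ->
  exists2 h : R, 0 < h & forall a b r, 0 <= a -> b <= T -> a <= r <= b ->
    b - a < h ->
    `|phi b - phi a - (b - a) * g (r, phi r)| <= e * (b - a).
Proof.
move=> gG T0 e0 Hphi; have e20 : 0 < e / 2 by rewrite divr_gt0.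
have [gc _] := gG; have [X X0 gX] := classG_neg g _ gG T0.
have [mu mu0 Hmu] := euler_approx g _ X _ gG T0 (ltW X0) gX e20.
pose E n := euler_polygon g (uniform_partition R n).
pose Q n := approx_solution g T (e / 2) (E n) /\
  forall s, 0 <= s <= T -> E n s <= X.
have Hn : \forall n \near \oo, Q n.
  have := uniform_partition_mesh mu mu0; apply: filterS => n Hn.
  apply: Hmu; first exact: uniform_partitionP.
  by move=> k s ks _; exact: Hn.
have phiX t : 0 <= t <= T -> 0 <= phi t <= X.
  move=> /[dup] tT /andP[t0 _]; apply/andP; split.
    apply: (cvgr_to_ge (Hphi t t0)).
    near=> n; have [[_ up _ _] _] : Q n by near: n.
    exact: up.
  apply: (cvgr_to_le (Hphi t t0)).
  near=> n; have [_ uX] : Q n by near: n.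
  exact: uX.
have [d d0 Hd] := field_unif_cont g T X _ gc e20.
have [C C0 HC] := field_bounded g T X gc.
have eC0 : 0 < e / 2 + C by rewrite addr_gt0.
(* [e / 2 + C] is a common Lipschitz constant of the fine polygons: over a length below [h], neither
   time nor the polygon moves by more than [d]. *)
exists (Num.min d (d / (e / 2 + C))); first by rewrite lt_min d0 divr_gt0.
move=> a b r a0 bT /andP[ar rb]; rewrite lt_min ltr_pdivlMr//.
move=> /andP[/ltW bad /ltW baC].
have ab : a <= b := le_trans ar rb.
have r0 : 0 <= r := le_trans a0 ar; have b0 := le_trans a0 ab.
have rT : 0 <= r <= T by rewrite r0 (le_trans rb).
have gr : g (r, E n r) @[n --> \oo] --> g (r, phi r).
  apply/cvgrPdist_le => e1 e10.
  have [d1 d10 Hd1] := field_unif_cont g T X _ gc e10.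
  have /cvgrPdist_le/(_ d1 d10) Hr := Hphi r r0.
  near=> n; apply: Hd1 => //; rewrite ?subrr ?normr0 ?(ltW d10)//.
  - exact: phiX.
  - have [[_ up _ _] _] : Q n by near: n.
    exact: up.
  - by near: n.
have lim : `|E n b - E n a - (b - a) * g (r, E n r)| @[n --> \oo] --> `|phi b - phi a - (b - a) * g (r, phi r)|.
  apply: cvg_norm; apply: cvgB; first by apply: cvgB; exact: Hphi.
  by apply: cvgM; [exact: cvg_cst|exact: gr].
apply: (cvgr_to_le lim).
near=> n; rewrite (splitr e).
have [Ha HX] : Q n by near: n.
apply: (approx_increment g T (e / 2) _ _ _ _ _ Ha) => // s /andP[as_ sb].
have sT : 0 <= s <= T by rewrite (le_trans a0)// (le_trans sb).
have [_ up _ _] := Ha.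
have lip p q : a <= p -> p <= q -> q <= b ->
    `|E n q - E n p| <= d.
  move=> ap pq qb; apply: le_trans baC; rewrite mulrC.
  have := approx_lipschitz g T (e / 2) X C p q _ Ha HX HC.
  move=> /(_ (le_trans a0 ap) pq (le_trans qb bT)) /le_trans; apply.
  by rewrite ler_wpM2l ?(ltW eC0)// lerB.
apply: Hd => //.
- by rewrite up//= HX.
- by rewrite up.
- by rewrite ler_norml; apply/andP; split; lra.
- by case: (lerP s r) => [sr|/ltW rs]; [rewrite distrC|]; apply: lip.
Unshelve. all: by end_near. Qed.

Lemma solution_exists {R : realType} (g : R * R -> R) :
  classG g -> exists phi : R -> R, C1_0 phi /\ global_solution g phi.
Proof.
move=> gG; have [gc _] := gG.
pose E n := euler_polygon g (uniform_partition R n).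
pose phi t := limn (fun n => E n t).
have Hphi t : 0 <= t -> E n t @[n --> \oo] --> phi t.
  by move=> t0; exact: uniform_polygon_cvg.
have phi0 : phi 0 = 0.
  rewrite /phi (_ : (fun n => E n 0) = fun=> 0) ?lim_cst//.
  by apply/funext => n; exact: euler_polygon0.
have phi_ge0 t : 0 <= t -> 0 <= phi t.
  move=> t0; apply: (cvgr_to_ge (Hphi t t0)).
  near=> n; rewrite /E /euler_polygon; case: ifP => //= _.
  by rewrite le_max lexx.
have dphi t : 0 <= t -> has_derivative_within (Rplus R) phi t (g (t, phi t)).
  move=> t0; apply/has_derivative_withinP => e e0.
  have t10 : 0 <= t + 1 by rewrite addr_ge0.
  have [h h0 H] := euler_limit_increment g phi (t + 1) e gG t10 e0 Hphi.
  (* The cap at 1 keeps [s] below the horizon [t + 1]. *)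
  exists (Num.min h 1); first by rewrite lt_min h0/=.
  move=> s s0; rewrite lt_min => /andP[sth st1].
  have [st|/ltW ts] := lerP s t.
    have := H s t t s0; rewrite lerDl ler01 st lexx => /(_ isT isT).
    move: sth; rewrite distrC ger0_norm ?subr_ge0// => sth /(_ sth).
    rewrite -normrN; congr (`| _ | <= _); lra.
  have := H t s t t0; rewrite lexx ts.
  rewrite ger0_norm ?subr_ge0// in sth st1 *.
  by apply => //; lra.
have cphi' : {within Rplus R, continuous (fun t => g (t, phi t))}.
  apply/subspace_continuousP => t t0; apply/cvgrPdist_le => e e0.
  have [d d0 Hd] := field_unif_cont g t (phi t) _ gc e0.
  have /has_derivative_within_cvg/cvgrPdist_le/(_ d d0) := dphi t t0.
  rewrite !near_withinE; apply: filter_app; near=> s; move=> + s0 => /(_ s0) ts.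
  apply: Hd => //; rewrite ?t0 ?lexx ?andbT//; try exact: phi_ge0.
have C1phi : C1_on (Rplus R) phi by exists (fun t => g (t, phi t)).
exists phi; split; first by split.
rewrite /global_solution /maximal_solution before_pinfty; split => //.
by rewrite max_l// leey.
Unshelve. all: by end_near. Qed.

(** * The upper bound *)

Lemma field_neg_near {R : realType} (g : R * R -> R) (t x : R) :
  {within Rplus2 R, continuous g} -> 0 <= t -> 0 <= x -> g (t, x) < 0 ->
  exists2 d : R, 0 < d & forall s y, 0 <= s -> 0 <= y ->
    `|t - s| <= d -> `|x - y| <= d -> g (s, y) < 0.
Proof.
move=> gc t0 x0 gtx; have e0 : 0 < - g (t, x) / 2 by rewrite divr_gt0 ?oppr_gt0.
have [d d0 Hd] := field_unif_cont g t x _ gc e0.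
exists d => // s y s0 y0 ts xy.
have := Hd t x s y; rewrite t0 x0 !lexx => /(_ isT isT s0 y0 ts xy).
by rewrite ler_norml => /andP[h _]; lra.
Qed.

(** This is the well-definedness of [phibar]: its [inf] is a genuine infimum and not a default
    value. *)
Lemma upper_set_has_inf {R : realType} (g : R * R -> R) (t : R) :
  classG g -> 0 <= t -> has_inf (upper_set g t).
Proof.
move=> gG t0; have [X X0 gX] := classG_neg g t gG t0.
by split; [exists X | exists 0 => x [/ltW]].
Qed.

Lemma phibar_le {R : realType} (g : R * R -> R) (t x : R) :
  0 < x -> g (t, x) < 0 -> phibar g t <= x.
Proof. by move=> x0 gx; apply: ge_inf => //; exists 0 => y [/ltW]. Qed.

Lemma phibar_ge0 {R : realType} (g : R * R -> R) (t : R) :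
  classG g -> 0 <= t -> 0 <= phibar g t.
Proof.
move=> gG t0; have [S0 _] := upper_set_has_inf g t gG t0.
by apply: lb_le_inf => // x [/ltW].
Qed.

Lemma phibar_nonpos {R : realType} (g : R * R -> R) (t : R) :
  classG g -> 0 <= t -> g (t, phibar g t) <= 0.
Proof.
move=> gG t0; have [gc _] := gG; have y0 := phibar_ge0 g t gG t0.
rewrite leNgt; apply/negP => gy.
have e0 : 0 < g (t, phibar g t) / 2 by rewrite divr_gt0.
have [d d0 Hd] := field_unif_cont g t (phibar g t) _ gc e0.
have [x [x0 gx] xy] := inf_adherent d0 (upper_set_has_inf g t gG t0).
have yx := phibar_le g t x x0 gx.
have := Hd t (phibar g t) t x.
rewrite t0 y0 !lexx subrr normr0 (ltW d0) (ltW x0) distrC.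
rewrite ger0_norm ?subr_ge0// => /(_ isT isT isT isT isT).
have xd : x - phibar g t <= d by rewrite lerBlDl ltW.
by move=> /(_ xd); rewrite ler_norml => /andP[_ h]; lra.
Qed.

(** The weak inequality [g (t, phibar g t) <= 0] becomes strict at the earlier time [s]; by
    continuity [g (s, _)] is then negative already slightly below [phibar g t]. *)
Lemma phibar_increasing {R : realType} (g : R * R -> R) :
  classG g -> strictly_increasing (phibar g).
Proof.
move=> gG s t s0 st; have [gc [_ gi _ _]] := gG.
have t0 : 0 <= t := le_trans s0 (ltW st).
have y0 := phibar_ge0 g t gG t0.
have gs : g (s, phibar g t) < 0.
  by apply: lt_le_trans (phibar_nonpos g t gG t0); exact: gi.
have yp : 0 < phibar g t.
  rewrite lt_neqAle y0 andbT; apply/eqP => yE.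
  by move: gs; rewrite -yE ltNge classG_ge0.
have [d d0 Hd] := field_neg_near g s _ gc s0 y0 gs.
(* The second term keeps the level positive, as membership in [upper_set] requires. *)
pose x := Num.max (phibar g t - d) (phibar g t / 2).
have x0 : 0 < x by rewrite lt_max orbC divr_gt0.
have xy : x < phibar g t by rewrite gt_max; apply/andP; split; lra.
have yx : phibar g t - d <= x by rewrite le_max lexx.
apply: (le_lt_trans _ xy); apply: phibar_le => //.
apply: Hd => //; [exact: ltW|by rewrite subrr normr0 ltW|].
by rewrite gtr0_norm ?subr_gt0//; lra.
Qed.

(** Right continuity: a level just above [phibar g t] where the field is negative remains such a
    level shortly after [t]. Left limits come from monotonicity. *)
Lemma phibar_cadlag {R : realType} (g : R * R -> R) :
  classG g -> cadlag (phibar g).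
Proof.
move=> gG; have [gc _] := gG; split.
- by move=> t t0; exact: phibar_ge0.
- move=> t t0; apply/cvgrPdist_le => e e0.
  have [x [x0 gx] xy] := inf_adherent e0 (upper_set_has_inf g t gG t0).
  have [d d0 Hd] := field_neg_near g t x gc t0 (ltW x0) gx.
  near=> s.
  have ts : t < s by near: s; exact: nbhs_right_gt.
  have sd : s - t < d by near: s; exact: nbhs_right_ltDr.
  have yts := phibar_increasing g gG t s t0 ts.
  have : phibar g s <= x.
    apply: phibar_le => //; apply: Hd; rewrite ?(ltW x0)//.
    - exact: le_trans t0 (ltW ts).
    - by rewrite distrC gtr0_norm ?subr_gt0// ltW.
    - by rewrite subrr normr0 ltW.
  rewrite distrC gtr0_norm ?subr_gt0// lerBlDl => /le_trans; apply.
  exact: ltW.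
- move=> t t0; apply/cvg_ex/nondecreasing_at_left_is_cvgr.
    near=> s; have s0 : 0 <= s by near: s; exact: nbhs_left_ge.
    move=> x y; rewrite !in_itv/= => /andP[sx xt] /andP[sy yt].
    rewrite le_eqVlt => /orP[/eqP->//|xy].
    exact/ltW/phibar_increasing/xy/(le_trans s0 (ltW sx)).
  near=> s; have s0 : 0 <= s by near: s; exact: nbhs_left_ge.
  exists (phibar g t) => y [x /=]; rewrite in_itv/= => /andP[sx xt] <-.
  exact/ltW/phibar_increasing/xt/(le_trans s0 (ltW sx)).
Unshelve. all: by end_near. Qed.

Lemma exact_solution_le_phibar {R : realType} (g : R * R -> R) u :
  classG g -> (forall T, exact_solution g T u) ->
  forall t, 0 <= t -> u t <= phibar g t.
Proof.
move=> gG Hu t t0; have [S0 _] := upper_set_has_inf g t gG t0.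
apply: lb_le_inf => // x [x0 gx].
apply: (exact_solution_le g t t x u gG (Hu t) (lexx t) (ltW x0) gx).
by rewrite t0 lexx.
Qed.

(** * Convergence in the weighted norms *)

Lemma weighted_sum_cvg0_term {R : realType} (a : nat -> nat -> \bar R)
    (N : nat) (e : R) :
  (forall n k, 0%E <= a n k)%E -> (0 < N)%N -> 0 < e ->
  weighted_sum (a n) @[n --> \oo] --> 0%E ->
  \forall n \near \oo, (a n N <= e%:E)%E.
Proof.
move=> a0 N0 e0 /fine_cvgP[wfin /cvgrPdist_lt wcvg].
(* Being below 1, [e'] can exceed [mine 1 (a n N)] only through [a n N] itself. *)
pose e' := Num.min e (1 / 2).
have e'0 : 0 < e' by rewrite lt_min e0 divr_gt0.
have c0 : 0 < 2^-1 ^+ N :> R by rewrite exprn_gt0// invr_gt0.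
have ce0 : 0 < 2^-1 ^+ N * e' by rewrite mulr_gt0.
have term_ge0 n k : (0 <= (2^-1 ^+ k)%:E * mine 1 (a n k))%E.
  apply: mule_ge0; first by rewrite lee_fin exprn_ge0// invr_ge0.
  by rewrite le_min lee01 a0.
near=> n.
have fin : weighted_sum (a n) \is a fin_num by near: n.
have small : fine (weighted_sum (a n)) < 2^-1 ^+ N * e'.
  have : `|0 - fine (weighted_sum (a n))| < 2^-1 ^+ N * e'.
    by near: n; exact: wcvg.
  by rewrite sub0r normrN; apply: le_lt_trans; exact: ler_norm.
have term : ((2^-1 ^+ N)%:E * mine 1 (a n N) <= weighted_sum (a n))%E.
  apply: le_trans (nneseries_lim_ge N.+1 _) => //.
  by rewrite big_nat_recr//= leeDr// sume_ge0.
have : ((2^-1 ^+ N)%:E * mine 1 (a n N) < (2^-1 ^+ N)%:E * e'%:E)%E.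
  by rewrite (le_lt_trans term)// -(fineK fin) -EFinM lte_fin.
rewrite lte_pmul2l ?lte_fin//.
rewrite gt_min => /orP[|].
  rewrite lte_fin ltNge => /negP[]; rewrite ge_min; apply/orP; right; lra.
by move=> /ltW/le_trans; apply; rewrite lee_fin ge_min lexx.
Unshelve. all: by end_near. Qed.

Lemma weighted_sum_le {R : realType} (a : nat -> \bar R) (K : nat) (e : R) :
  (forall k, 0%E <= a k)%E -> 0 <= e ->
  (forall k, (0 < k <= K)%N -> (a k <= e%:E)%E) ->
  (weighted_sum a <= (K%:R * e + 2^-1 ^+ K)%:E)%E.
Proof.
move=> a0 e0 aK.
have h0 k : 0 <= 2^-1 ^+ k :> R by rewrite exprn_ge0// invr_ge0.
have term_ge0 k : (0 <= (2^-1 ^+ k)%:E * mine 1 (a k))%E.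
  by rewrite mule_ge0 ?lee_fin// le_min lee01 a0.
rewrite /weighted_sum (nneseries_split 1 K)// EFinD leeD//.
  apply: (@le_trans _ _ (\sum_(1 <= k < 1 + K) e%:E)%E).
    rewrite !big_nat; apply: lee_sum => k; rewrite add1n ltnS => kK.
    apply: (@le_trans _ _ (1 * e%:E)%E); last by rewrite mul1e.
    apply: lee_pmul.
    - by rewrite lee_fin.
    - by rewrite le_min lee01 a0.
    - by rewrite lee_fin exprn_ile1 ?invr_ge0// invf_le1// ler1n.
    - by rewrite ge_min aK// orbT.
  by rewrite sumEFin sumr_const_nat add1n subn1 mulr_natl.
rewrite -nneseries_addn//.
(* The cap at 1 bounds the tail by the geometric series of the weights after index [K], whose sum is
   [2^-K]. *)
apply: le_trans (epsilon_trick0 xpredT (h0 K)).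
apply: lee_nneseries => // k _.
rewrite (_ : 2^-1 ^+ K / _ = 2^-1 ^+ (k + (1 + K))); last first.
  by rewrite natrX -exprVn -exprD addnA addn1 addnC.
rewrite -[leRHS]mule1 lee_wpmul2l ?lee_fin//.
by rewrite ge_min lexx.
Qed.

Lemma weighted_sum_cvg0 {R : realType} (a : nat -> nat -> \bar R) :
  (forall n k, 0%E <= a n k)%E ->
  (forall (N : nat) (e : R), 0 < e ->
    \forall n \near \oo, (a n N <= e%:E)%E) ->
  weighted_sum (a n) @[n --> \oo] --> 0%E.
Proof.
move=> a0 acvg.
have w0 n : (0 <= weighted_sum (a n))%E.
  apply: nneseries_ge0 => k _ _; rewrite mule_ge0 ?lee_fin ?exprn_ge0 ?invr_ge0//.
  by rewrite le_min lee01 a0.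
have acvg' (K : nat) (e : R) : 0 < e ->
    \forall n \near \oo, forall k, (0 < k <= K)%N -> (a n k <= e%:E)%E.
  move=> e0; elim: K => [|K ih]; first by near=> n => k; case: k.
  near=> n => k /andP[k0]; rewrite leq_eqVlt => /orP[/eqP->|kK].
    by near: n; exact: acvg.
  have ihn : forall k, (0 < k <= K)%N -> (a n k <= e%:E)%E by near: n.
  by apply: ihn; rewrite k0 -ltnS.
have wle (e : R) : 0 < e -> \forall n \near \oo, (weighted_sum (a n) <= e%:E)%E.
  move=> e0; have e20 : 0 < e / 2 by rewrite divr_gt0.
  have [K _ HK] : \forall K \near \oo, 2^-1 ^+ K <= e / 2 :> R.
    have : (2^-1 : R) ^+ K @[K --> \oo] --> (0 : R).
      by apply: cvg_expr; rewrite ger0_norm ?invr_ge0// invf_lt1// ltr1n.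
    move=> /cvgrPdist_le/(_ _ e20); apply: filterS => K.
    by rewrite sub0r normrN ger0_norm// exprn_ge0// invr_ge0.
  (* The [K] head terms share [e / 2]; dividing by [K.+1] covers [K = 0]. *)
  have eK0 : 0 < e / 2 / K.+1%:R by rewrite divr_gt0.
  have := acvg' K _ eK0; apply: filterS => n /weighted_sum_le.
  move=> /(_ (a0 n) (ltW eK0))/le_trans; apply; rewrite lee_fin [leRHS]splitr.
  apply: lerD; last by apply: HK => /=.
  rewrite mulrA ler_pdivrMr// mulrC ler_wpM2l ?(ltW e20)// ler_nat.
  exact: leqnSn.
apply/fine_cvgP; split.
  have := wle 1 ltr01; apply: filterS => n wn.
  rewrite fin_numE gt_eqF ?(lt_le_trans _ (w0 n))//= lt_eqF//.
  by rewrite (le_lt_trans wn)// ltry.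
apply/cvgrPdist_le => e e0; have := wle e e0; apply: filterS => n wn.
rewrite sub0r normrN ger0_norm ?fine_ge0// -lee_fin fineK//.
rewrite fin_numE gt_eqF ?(lt_le_trans _ (w0 n))//= lt_eqF//.
by rewrite (le_lt_trans wn)// ltry.
Unshelve. all: by end_near. Qed.

Lemma path_norm_cvg0 {R : realType} (w : nat -> R -> R) :
  (forall (N : nat) (e : R), 0 < e -> \forall n \near \oo,
    forall t, 0 <= t <= N%:R -> `|w n t| <= e) ->
  path_norm (w n) @[n --> \oo] --> 0%E.
Proof.
move=> wcvg; apply: weighted_sum_cvg0 => [n N|N e e0].
  apply: (@le_trans _ _ `|w n 0|%:E); first by rewrite lee_fin.
  by apply: ereal_sup_ubound; exists 0 => //=; rewrite in_itv/= lexx ler0n.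
have := wcvg N e e0; apply: filterS => n wn.
apply: ge_ereal_sup => y [t /=]; rewrite in_itv/= => tN <-.
by rewrite lee_fin wn.
Qed.

Lemma field_norm_near {R : realType} (h : nat -> R * R -> R) (N : nat)
    (e : R) : 0 < e -> field_norm (h n) @[n --> \oo] --> 0%E ->
  \forall n \near \oo, forall t x, 0 <= t <= N%:R -> 0 <= x <= N%:R ->
    `|h n (t, x)| <= e.
Proof.
move=> e0 hcvg; have NS : N%:R <= N.+1%:R :> R by rewrite ler_nat.
pose sup_sq n (k : nat) :=
  ereal_sup [set `|h n p|%:E | p in `[0, k%:R] `*` `[0, k%:R]].
have sup_ge0 n k : (0 <= sup_sq n k)%E.
  apply: (@le_trans _ _ `|h n (0, 0)|%:E); first by rewrite lee_fin.
  apply: ereal_sup_ubound; exists (0, 0) => //=.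
  by split; rewrite /= in_itv/= lexx ler0n.
(* The weighted sum starts at index 1, whereas [N] may be 0. *)
have := weighted_sum_cvg0_term sup_sq N.+1 e sup_ge0 (ltn0Sn N) e0 hcvg.
apply: filterS => n hn t x /andP[t0 tN] /andP[x0 xN].
rewrite -lee_fin; apply: le_trans hn; apply: ereal_sup_ubound.
exists (t, x) => //; split; rewrite /= in_itv/= ?t0 ?x0; exact: le_trans NS.
Qed.

(** The horizon [N.+1] provides the extra unit of time that [euler_polygon_cvg] asks for. *)
Lemma partition_norm_near {R : realType} (pi : nat -> nat -> R) (N : nat)
    (e : R) : 0 < e -> (forall n, is_partition (pi n)) ->
  partition_norm (pi n) @[n --> \oo] --> 0%E ->
  \forall n \near \oo, forall k t, pi n k < t <= pi n k.+1 -> t <= N.+1%:R ->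
    t - pi n k <= e.
Proof.
move=> e0 hpi hcvg.
have mesh_ge0 n k : (0 <= mesh (pi n) k%:R)%E.
  apply: (@le_trans _ _ (Num.min (pi n 1%N) k%:R - Num.min (pi n 0%N) k%:R)%:E).
    rewrite lee_fin subr_ge0 le_min ge_min ge_min lexx orbT andbT.
    by rewrite partition_le.
  by apply: ereal_sup_ubound; exists 0%N.
have := weighted_sum_cvg0_term _ N.+1 e mesh_ge0 (ltn0Sn N) e0 hcvg.
apply: filterS => n hn k t /andP[kt tk] tN.
rewrite -lee_fin; apply: le_trans hn.
apply: (@le_trans _ _
    (Num.min (pi n k.+1) N.+1%:R - Num.min (pi n k) N.+1%:R)%:E).
  by rewrite lee_fin lerB// ?le_min ?tk// ge_min lexx.
by apply: ereal_sup_ubound; exists k.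
Qed.

(** * Assembling the assertions for global solutions *)

Lemma global_solution_exact {R : realType} (g : R * R -> R) (phi : R -> R) :
  global_solution g phi -> forall T, exact_solution g T phi.
Proof. by move=> Hphi T; apply: maximal_solution_exact Hphi (ltry T). Qed.

Lemma maximal_solution_unique {R : realType} (g : R * R -> R) (phi : R -> R) :
  classG g -> global_solution g phi -> unique_maximal_solution g +oo%E phi.
Proof.
move=> gG Hphi; split => // T psi Hpsi.
have TE := maximal_solution_global g T psi gG Hpsi; subst T; split => // t.
rewrite inE => -[t0 _].
exact: (exact_solution_unique g psi phi gG (global_solution_exact g psi Hpsi)
  (global_solution_exact g phi Hphi) t t0).
Qed.

Lemma solution_map_continuous {R : realType} (g_ : nat -> R * R -> R)
    (phi_ : nat -> R -> R) :
  (forall n, classG (g_ n)) -> (forall n, global_solution (g_ n) (phi_ n)) ->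
  field_norm (fun p => g_ 0%N p - g_ n p) @[n --> \oo] --> 0%E ->
  path_norm (fun t => phi_ 0%N t - phi_ n t) @[n --> \oo] --> 0%E.
Proof.
move=> gG Hphi gcvg; apply: path_norm_cvg0 => T e e0.
have Hex n := global_solution_exact (g_ n) (phi_ n) (Hphi n).
have [N [eta eta0 H]] := exact_solution_stability (g_ 0%N) T%:R e _ (gG 0%N)
  (Hex 0%N) (ler0n _ T) e0.
have := field_norm_near _ N eta eta0 gcvg; apply: filterS => n gn.
exact: (H _ _ (gG n) (Hex n) gn).
Qed.

Lemma euler_path_norm_cvg {R : realType} (g : R * R -> R) (phi : R -> R)
    (pi_ : nat -> nat -> R) :
  classG g -> global_solution g phi -> (forall n, is_partition (pi_ n)) ->
  partition_norm (pi_ n) @[n --> \oo] --> 0%E ->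
  path_norm (fun t => phi t - euler_polygon g (pi_ n) t) @[n --> \oo] --> 0%E.
Proof.
move=> gG Hphi hpi picvg; apply: path_norm_cvg0 => T e e0.
have [mu mu0 H] := euler_polygon_cvg g T%:R e phi gG
  (global_solution_exact g phi Hphi) (ler0n _ T) e0.
have := partition_norm_near pi_ T mu mu0 hpi picvg; apply: filterS => n hn.
apply: H => // k t kt tT; apply: hn => //.
by rewrite -natr1.
Qed.
Theorem mainTheorem5 (R : realType) (g : R * R -> R) (hg : classG g) :
  exists phi : R -> R,
  [/\ (* 1: global existence and uniqueness *)
      [/\ unique_maximal_solution g +oo%E phi,
          strictly_increasing phi, unbounded phi, C1_0 phi &
          unique_global_solution g phi],
      (* 2: upper bound *)
      [/\ forall t : R, 0 <= t -> has_inf (upper_set g t),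
          strictly_increasing (phibar g), unbounded (phibar g),
          cadlag (phibar g) &
          forall t : R, 0 <= t -> phi t <= phibar g t],
      (* 3: continuous dependence *)
      forall (g_ : nat -> R * R -> R) (phi_ : nat -> R -> R),
        (forall n, classG (g_ n)) ->
        (forall n, global_solution (g_ n) (phi_ n)) ->
        field_norm (fun p => g_ 0%N p - g_ n p) @[n --> \oo] --> 0%E ->
        path_norm (fun t => phi_ 0%N t - phi_ n t) @[n --> \oo] --> 0%E &
      (* 4: simulation convergence *)
      forall pi_ : nat -> nat -> R,
        (forall n, is_partition (pi_ n)) ->
        partition_norm (pi_ n) @[n --> \oo] --> 0%E ->
        path_norm (fun t => phi t - euler_polygon g (pi_ n) t)
          @[n --> \oo] --> 0%E].
Proof.
have [phi [C1phi Hphi]] := solution_exists g hg.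
have Hex := global_solution_exact g phi Hphi.
have uniq_phi := maximal_solution_unique g phi hg Hphi.
have phi_unb := exact_solution_unbounded g phi hg Hex.
have le_bar := exact_solution_le_phibar g phi hg Hex.
exists phi; split.
- have [_ uniq] := uniq_phi; split => //.
    exact: exact_solution_increasing Hex.
  split => // psi Hpsi; rewrite -before_pinfty.
  by have [] := uniq _ _ Hpsi.
- split => //.
  + by move=> t; exact: upper_set_has_inf.
  + exact: phibar_increasing.
  (* Since [0 <= phi <= phibar g], a bound on [phibar g] would bound [phi]. *)
  + move=> [M [Mreal HM]]; apply: phi_unb.
    exists M; split => // N /HM HN t t0 /=.
    have [_ phi_ge0 _] := C1phi.
    rewrite ger0_norm ?phi_ge0// (le_trans (le_bar t t0))//.
    by rewrite (le_trans (ler_norm _))// HN.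
  + exact: phibar_cadlag.
- by move=> g_ phi_; exact: solution_map_continuous.
- by move=> pi_; exact: euler_path_norm_cvg.
Qed.
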